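(* Let $s\geqslant 1$ be an integer. In the setting of the context, suppose that: (1) (Restricted Eigenvalue) $\displaystyle \zeta(s)=\min_{J_0\subset\{1,\ldots,M\}:|J_0|\leqslant s}\ \min_{\Delta\in\mathbb{R}^M,\ \Delta\neq 0:\ |\Delta_{J_0^c}|_1\leqslant|\Delta_{J_0}|_1}\frac{\|f_\Delta\|}{|\Delta_{J_0}|_2}>0$; (2) $\|f_{\theta^*}\|_\infty\leqslant K$ for a constant $K>0$; (3) (Margin) there are constants $c>0$ (possibly depending on $K$) and $1<\kappa\leqslant 2$ such that $\|f_\theta-f_{\theta^*}\|\leqslant c\,(R(\theta)-R(\theta^* ))^{1/\kappa}$ for every $\theta\in\Theta$; (4) $1\leqslant K,L\leqslant\sqrt{n/\log M}$. Let $r=6\|\partial_u\gamma\|_\infty\tilde r$ and assume $M(\theta^* )\leqslant s$. Then, with probability at least $1-M^{-1}-M^{-K}-3M^{-2K}\log\frac{n}{\log M}$, both $$\sup_{\hat\theta\in\hat\Theta}\mathcal{E}(\hat\theta)\leqslant\left(\frac{2(1+2K)cr\sqrt{s}}{\zeta(s)}\right)^{\frac{\kappa}{\kappa-1}}+12\|\partial_u\gamma\|_\infty\frac{\kappa}{\kappa-1}\tilde r^2$$ and $$\sup_{\hat\theta\in\hat\Theta}|\hat\theta-\theta^*|_1\leqslant\left(\frac{2c\sqrt{s}}{\zeta(s)}\right)^{\frac{\kappa}{\kappa-1}}\big((1+2K)r\big)^{\frac{1}{\kappa-1}}+\frac{2K}{(\kappa-1)(1+2K)}\tilde r .$$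
   Context: Data: $Z_i=(X_i,Y_i)$, $i=1,\ldots,n$, are i.i.d. copies of $Z=(X,Y)$ with values in a measurable space $\mathcal{X}\times\mathcal{Y}$; $P^X$ is the law of $X$. For $g:\mathcal{X}\to\mathbb{R}$, $\|g\|_\infty$ is the essential supremum of $|g|$ and $\|g\|=(\int g^2\,dP^X)^{1/2}$. The dictionary $f_1,\ldots,f_M:\mathcal{X}\to\mathbb{R}$, $M\geqslant 2$, satisfies $\|f_j\|=1$ and $\|f_j\|_\infty\leqslant L$ for all $j$, where $L>0$. For $\theta\in\mathbb{R}^M$: $f_\theta=\sum_{j=1}^M\theta_jf_j$, $J(\theta)=\{j:\theta_j\neq0\}$, $M(\theta)=|J(\theta)|$; $\theta_J$ is the vector equal to $\theta$ on $J$ and $0$ on $J^c$; $|\cdot|_p$ and $|\cdot|_\infty$ are the usual $l_p$ and sup norms of vectors. Loss: $\gamma:\mathcal{Y}\times\mathbb{R}\to\mathbb{R}^+$ satisfies $|\gamma(y,u)-\gamma(y,u')|\leqslant|u-u'|$ for all $y,u,u'$; for each $y$, $\gamma(y,\cdot)$ is convex and differentiable with absolutely continuous derivative $\partial_u\gamma(y,\cdot)$; $\|\partial_u\gamma\|_\infty=\sup_{y,u}|\partial_u\gamma(y,u)|$. Put $Q(z,\theta)=\gamma(y,f_\theta(x))$ for $z=(x,y)$, $R(\theta)=\mathbb{E}\,Q(Z,\theta)$, $\hat R_n(\theta)=\frac1n\sum_{i=1}^nQ(Z_i,\theta)$. The vector $\theta^*$ is a minimizer of $R$ over $\mathbb{R}^M$;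 it is assumed that there is a minimizer with $M(\theta^* )\leqslant s$ and that this sparse minimizer is unique. The excess risk is $\mathcal{E}(\theta)=R(\theta)-R(\theta^* )$. Estimator: $\Theta=\{\theta\in\mathbb{R}^M:\|f_\theta\|_\infty\leqslant K\}$, and $\hat\Theta$ is the (random) set of all solutions of: minimize $|\theta|_1$ over $\theta\in\Theta$ subject to $|\nabla\hat R_n(\theta)|_\infty\leqslant r$. A supremum over $\hat\Theta$ bounded by a quantity means the bound holds for every $\hat\theta\in\hat\Theta$. Also $\tilde r=4\sqrt2\,L\frac{\log M}{n}+2\sqrt6\sqrt{\frac{\log M}{n}}$, and it is assumed throughout that $\tilde r\leqslant1$. *)

(* Defs.v *)
From HB Require Import structures.
From mathcomp Require Import all_boot all_order all_algebra.
From mathcomp Require Import all_classical all_reals all_analysis.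

Set Implicit Arguments.
Unset Strict Implicit.
Unset Printing Implicit Defensive.

Import Order.TTheory GRing.Theory Num.Theory.
Import numFieldNormedType.Exports.

Local Open Scope classical_set_scope.
Local Open Scope ring_scope.

Section Vectors.
Context {R : realType} {M : nat}.
Implicit Types (theta : 'rV[R]_M) (J : {set 'I_M}).

(* The sup norm |.|_oo on 'rV[R]_M is the library norm `|theta|. *)
Definition l1norm theta : R := \sum_j `|theta 0 j|.
Definition l2norm theta : R := Num.sqrt (\sum_j theta 0 j ^+ 2).

Definition vsupp theta : {set 'I_M} := [set j | theta 0 j != 0].
Definition vrestr theta J : 'rV[R]_M :=
  \row_j (if j \in J then theta 0 j else 0).

Definition grad (F : 'rV[R]_M -> R) theta : 'rV[R]_M :=
  \row_j 'D_(delta_mx 0 j) F theta.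

End Vectors.

Section Randomness.
Context {d d' : measure_display} {Omega : measurableType d}
  {T : measurableType d'} {R : realType} (P : probability Omega R).

Definition identically_distributed (U V : Omega -> T) : Prop :=
  forall A, measurable A -> P (U @^-1` A) = P (V @^-1` A).

Definition mutually_independent n (Z : 'I_n -> Omega -> T) : Prop :=
  forall (J : {set 'I_n}) (A : 'I_n -> set T),
    (forall i, measurable (A i)) ->
    P (\bigcap_(i in [set` J]) (Z i @^-1` A i)) =
    (\prod_(i in J) P (Z i @^-1` A i))%E.

End Randomness.

(* Absolute continuity on every compact interval; for a bounded monotone
   function (such as the derivative of a Lipschitz convex function) this is
   the same as absolute continuity on the whole line. *)
Definition absolutely_continuous {R : realType} (g : R -> R) : Prop :=
  forall a b e : R, 0 < e -> exists2 delta : R, 0 < delta &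
    forall m (u v : 'I_m -> R),
      (forall i, [/\ a <= u i, u i <= v i & v i <= b]) ->
      trivIset [set: 'I_m] (fun i => `]u i, v i[%classic) ->
      \sum_i (v i - u i) < delta ->
      \sum_i `|g (v i) - g (u i)| < e.

Definition dsup {R : realType} {YT : Type} (gamma : YT -> R -> R) : R :=
  sup [set `|derive1 (gamma yu.1) yu.2| | yu in [set: YT * R]].

HB.instance Definition _ (dX dY : measure_display) (XT : measurableType dX)
    (YT : measurableType dY) :=
  isMeasurableFun.Build _ _ _ _ (@fst XT YT) measurable_fst.

Definition lawX {d dX dY : measure_display} {Omega : measurableType d}
    {XT : measurableType dX} {YT : measurableType dY} {R : realType}
    (P : probability Omega R) (Z : {RV P >-> (XT * YT)%type}) :
    probability XT R :=
  distribution P (fst \o Z).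

Section Dictionary.
Context {dX : measure_display} {XT : measurableType dX} {R : realType} {M : nat}
  (PX : probability XT R) (f : 'I_M -> XT -> R).

Definition fsum (theta : 'rV[R]_M) : XT -> R :=
  fun x => \sum_j theta 0 j * f j x.

Definition normoo (g : XT -> R) : \bar R := ('N[PX]_+oo[EFin \o g])%E.

(* [fine] is harmless: linear combinations of functions of norm 1 have finite
   norm. *)
Definition norm2 (g : XT -> R) : R := fine ('N[PX]_2%:E[EFin \o g])%E.

(* The minimum is attained (homogeneity and compactness), so it is the infimum;
   the denominator cannot vanish under the constraints on [Delta]. *)
Definition zeta (s : nat) : R :=
  inf [set q | exists (J0 : {set 'I_M}) (Delta : 'rV[R]_M),
    [/\ (#|J0| <= s)%N, Delta != 0,
        l1norm (vrestr Delta (~: J0)) <= l1norm (vrestr Delta J0) &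
        q = norm2 (fsum Delta) / l2norm (vrestr Delta J0)]].

Definition Theta (K : R) : set 'rV[R]_M :=
  [set theta | (normoo (fsum theta) <= K%:E)%E].

End Dictionary.

Section Estimation.
Context {dX dY : measure_display} {XT : measurableType dX}
  {YT : measurableType dY} {R : realType} {M : nat}
  (gamma : YT -> R -> R) (f : 'I_M -> XT -> R).

Definition Qloss (z : XT * YT) (theta : 'rV[R]_M) : R :=
  gamma z.2 (fsum f theta z.1).

Definition risk {d} {Omega : measurableType d} (P : probability Omega R)
    (Z : Omega -> XT * YT) (theta : 'rV[R]_M) : R :=
  fine ('E_P[fun w => Qloss (Z w) theta])%E.

Definition emp_risk n (z : 'I_n -> XT * YT) (theta : 'rV[R]_M) : R :=
  n%:R^-1 * \sum_i Qloss (z i) theta.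

Definition Thetahat n (z : 'I_n -> XT * YT) (PX : probability XT R) (K r : R) :
    set 'rV[R]_M :=
  let feasible theta := Theta PX f K theta /\ `|grad (emp_risk z) theta| <= r in
  [set theta | feasible theta /\
    forall theta', feasible theta' -> l1norm theta <= l1norm theta'].

End Estimation.

(* Main.v *)
(** Write Delta for the difference of an estimator and the target [theta].
    Convexity of the loss and the constraint on the empirical gradient bound
    the empirical excess risk by r |Delta|_1, so what is needed is a one-sided
    bound, uniform in Delta, of the difference between the true and the
    empirical excess risk, of the form 2 K r |Delta|_1 + 2 r rt.

    On an l1-ball the exponential moment of the supremum of this difference is
    estimated directly.  Symmetrization and the contraction principle, applied
    to one observation at a time, replace the increments of the loss by linear
    functions of Delta, whose maximum over the ball is governed by its 2 M
    vertices; the exponential moments at the vertices factorize over the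
    sample.  Chernoff's bound then suffices, without any concentration
    inequality for suprema.  Peeling with ratio 4 covers all radii from
    4 rt / K to 1 / (6 rt), and beyond them the trivial bound 2 K D on the
    excess risk, D being the sup norm of the derivative of the loss, is at
    most 2 K r |Delta|_1.

    As the target is feasible with high probability, the minimality of the
    l1-norm puts Delta in the cone of the restricted eigenvalue condition.  The
    margin condition then bounds |Delta|_1 by a power of the excess risk, and
    Young's inequality solves the resulting system. *)

Require Import Defs.
From HB Require Import structures.
From mathcomp Require Import all_boot all_order all_algebra.
From mathcomp Require Import all_classical all_reals all_analysis.
From mathcomp Require Import measurable_realfun ess_sup_inf ring lra.
Import Order.TTheory GRing.Theory Num.Theory.
Import numFieldNormedType.Exports.
Local Open Scope classical_set_scope.
Local Open Scope ring_scope.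

Set Implicit Arguments.
Unset Strict Implicit.
Unset Printing Implicit Defensive.

(** * Contraction and symmetrization for finite maxima of exponentials *)

(** Convexity and monotonicity of exp, in the form in which [contraction] compares two pairs of
    terms. *)
Lemma expR_increment (R : realType) (x y h h' : R) : y <= x -> 0 <= h -> h <= h' ->
  expR (y + h) - expR y <= expR (x + h') - expR x.
Proof.
move=> yx h0 hh'.
have e z k : expR (z + k) - expR z = expR z * (expR k - 1) by rewrite expRD; ring.
rewrite (e _ y h) (e _ x h'); apply: ler_pM; rewrite ?expR_ge0 ?subr_ge0 ?ler_expR//.
  by rewrite -(expR0 R) ler_expR.
by rewrite lerD2r ler_expR.
Qed.

(* The Ledoux-Talagrand contraction principle for a single random sign. *)
Lemma contraction (R : realType) (I : finType) (i0 : I) (A g u : I -> R) :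
    (forall t, `|g t| <= `|u t|) ->
    (forall t t', `|g t - g t'| <= `|u t - u t'|) ->
  \big[Num.max/0]_t expR (A t + g t) + \big[Num.max/0]_t expR (A t - g t) <=
  \big[Num.max/0]_t expR (A t + u t) + \big[Num.max/0]_t expR (A t - u t).
Proof.
move=> gu ggu.
(* The maxima start from 0, which is harmless for exponentials; as [I] is inhabited they are
   attained, at [a] for + g and at [b] for - g. *)
have [a _ Ea] := @eq_bigmax _ _ I 0 i0 xpredT (fun t => expR (A t + g t)) isT
  (fun t _ => expR_ge0 _).
have [b _ Eb] := @eq_bigmax _ _ I 0 i0 xpredT (fun t => expR (A t - g t)) isT
  (fun t _ => expR_ge0 _).
have maxa : A b + g b <= A a + g a.
  by rewrite -ler_expR -Ea; exact: (le_bigmax _ (fun t => expR (A t + g t))).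
have maxb : A a - g a <= A b - g b.
  by rewrite -ler_expR -Eb; exact: (le_bigmax _ (fun t => expR (A t - g t))).
rewrite Ea Eb.
have Up t : expR (A t + u t) <= \big[Num.max/0]_t expR (A t + u t).
  exact: (le_bigmax _ (fun t => expR (A t + u t))).
have Um t : expR (A t - u t) <= \big[Num.max/0]_t expR (A t - u t).
  exact: (le_bigmax _ (fun t => expR (A t - u t))).
have [ga gb] := (gu a, gu b); have gab := ggu a b.
(* The two maximal terms are paired with two terms on the right, one for each sign of u; which
   pairing works depends on the signs and sizes of [u a] and [u b]. *)
suff [H|H] : expR (A a + g a) + expR (A b - g b) <= expR (A a + u a) + expR (A b - u b)
  \/ expR (A a + g a) + expR (A b - g b) <= expR (A b + u b) + expR (A a - u a).
- by apply: (le_trans H); exact: lerD.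
- by apply: (le_trans H); exact: lerD.
have inc := @expR_increment R.
move: ga gb gab maxa maxb inc {Up Um Ea Eb}.
move: (A a) (A b) (g a) (g b) (u a) (u b) => xa xb pa pb ta tb.
rewrite !ler_norml => /andP[g1 g2] /andP[g3 g4] /andP[g5 g6] maxa maxb inc.
(* For opposite signs of [u a] and [u b], |g| <= |u| gives the bound term by term. For equal signs
   the loss in one term is made up by the gain in the other: convexity applies because [a] and [b]
   are maximizers and |g a - g b| <= |u a - u b|. *)
have [ta0|ta0] := leP 0 ta; have [tb0|tb0] := leP 0 tb.
- move: g1 g2 g3 g4 g5 g6; rewrite (ger0_norm ta0) (ger0_norm tb0) => g1 g2 g3 g4.
  have [tab|tab] := leP tb ta.
    rewrite ger0_norm ?subr_ge0// => g5 g6; left.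
    have := inc (xa + pa) (xb - tb) (tb - pb) (ta - pa).
    rewrite (_ : xb - tb + _ = xb - pb); last by ring.
    rewrite (_ : xa + pa + _ = xa + ta); last by ring.
    by move=> /(_ ltac:(lra) ltac:(lra) ltac:(lra)); lra.
  rewrite ltr0_norm ?subr_lt0// => g5 g6; right.
  have := inc (xb - pb) (xa - ta) (pa + ta) (pb + tb).
  rewrite (_ : xa - ta + _ = xa + pa); last by ring.
  rewrite (_ : xb - pb + _ = xb + tb); last by ring.
  by move=> /(_ ltac:(lra) ltac:(lra) ltac:(lra)); lra.
- left; move: g1 g2 g3 g4; rewrite (ger0_norm ta0) (ltr0_norm tb0) => g1 g2 g3 g4.
  by apply: lerD; rewrite ler_expR; lra.
- right; move: g1 g2 g3 g4; rewrite (ger0_norm tb0) (ltr0_norm ta0) => g1 g2 g3 g4.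
  by rewrite addrC; apply: lerD; rewrite ler_expR; lra.
- move: g1 g2 g3 g4 g5 g6; rewrite (ltr0_norm ta0) (ltr0_norm tb0) => g1 g2 g3 g4.
  have [tab|tab] := leP tb ta.
    rewrite ger0_norm ?subr_ge0// => g5 g6; left.
    have := inc (xb - pb) (xa + ta) (pa - ta) (pb - tb).
    rewrite (_ : xa + ta + _ = xa + pa); last by ring.
    rewrite (_ : xb - pb + _ = xb - tb); last by ring.
    by move=> /(_ ltac:(lra) ltac:(lra) ltac:(lra)); lra.
  rewrite ltr0_norm ?subr_lt0// => g5 g6; right.
  have := inc (xa + pa) (xb + tb) (- tb - pb) (- ta - pa).
  rewrite (_ : xb + tb + _ = xb - pb); last by ring.
  rewrite (_ : xa + pa + _ = xa - ta); last by ring.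
  by move=> /(_ ltac:(lra) ltac:(lra) ltac:(lra)); lra.
Qed.

Lemma integral_probability_cst (R : realType) (d : measure_display)
    (T : measurableType d) (mu : probability T R) (x : \bar R) :
  (\int[mu]__ x = x)%E.
Proof. by rewrite -[LHS]/(\int[mu]_z cst x z)%E integral_cst//= probability_setT mule1. Qed.

Lemma expR_AM_GM (R : realType) (x y : R) :
  expR (x + y) <= 2^-1 * (expR (2 * x) + expR (2 * y)).
Proof.
rewrite expRD; have := sqr_ge0 (expR x - expR y).
rewrite (_ : 2 * x = x + x); last by ring.
rewrite (_ : 2 * y = y + y); last by ring.
by rewrite !expRD; nra.
Qed.

(** Integrate the tangent of exp at the mean m of g, exp g >= exp m (1 - m + g). An infinite
    right-hand side is set aside first, since exp g need not be integrable. *)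
Lemma expR_jensen (R : realType) (d : measure_display) (T : measurableType d)
    (mu : probability T R) (g : T -> R) :
  mu.-integrable setT (EFin \o g) ->
  ((expR (fine (\int[mu]_z (g z)%:E)))%:E <= \int[mu]_z (expR (g z))%:E)%E.
Proof.
move=> ig; set m := fine _.
have mE : (\int[mu]_z (g z)%:E = m%:E)%E.
  by rewrite fineK//; exact: integrable_fin_num.
have mg : measurable_fun setT g by apply/measurable_EFinP; exact: (measurable_int mu).
have mexp : measurable_fun setT (fun z => (expR (g z))%:E).
  by apply/measurable_EFinP; exact: measurableT_comp.
have [->|fin] := eqVneq (\int[mu]_z (expR (g z))%:E)%E +oo%E; first by rewrite leey.
have iexp : mu.-integrable setT (fun z => (expR (g z))%:E).
  apply/integrableP; split => //.
  under eq_integral do rewrite gee0_abs ?lee_fin ?expR_ge0//.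
  by rewrite ltey.
have ilow : mu.-integrable setT (fun z => ((expR m)%:E * ((1 - m)%:E + (g z)%:E))%E).
  apply: integrableZl => //; apply: integrableD => //.
  exact: finite_measure_integrable_cst.
have -> : ((expR m)%:E = \int[mu]_z ((expR m)%:E * ((1 - m)%:E + (g z)%:E)))%E.
  rewrite integralZl//; last first.
    apply: integrableD => //; exact: finite_measure_integrable_cst.
  rewrite integralD//; last exact: finite_measure_integrable_cst.
  rewrite integral_probability_cst mE -EFinD -EFinM; congr EFin.
  by rewrite subrK mulr1.
apply: le_integral => // z _.
rewrite -EFinD -EFinM lee_fin.
have -> : expR (g z) = expR m * expR (g z - m) by rewrite -expRD addrC subrK.
rewrite ler_pM2l ?expR_gt0//; apply: le_trans (expR_ge1Dx (g z - m)).
by rewrite le_eqVlt; apply/orP; left; apply/eqP; ring.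
Qed.

Lemma measurable_bigmax (R : realType) (d : measure_display) (T : measurableType d)
    (I : finType) (F : I -> T -> R) :
  (forall t, measurable_fun setT (F t)) ->
  measurable_fun setT (fun z => \big[Num.max/0]_t F t z).
Proof.
move=> mF.
rewrite (_ : (fun z => _) = (fun z => \big[Num.max/0]_(t <- index_enum I) F t z))//.
elim: (index_enum I) => [|t s IH].
  by under eq_fun do rewrite big_nil; exact: measurable_cst.
under eq_fun do rewrite big_cons.
exact: measurable_maxr.
Qed.

(* Jensen's inequality brings in an independent copy z' of z, and
   exp (x - y) <= (exp (2 x) + exp (- 2 y)) / 2 separates z from z': a product
   space carrying copies and random signs is not needed. *)
Lemma symmetrization (R : realType) (d : measure_display) (T : measurableType d)
    (mu : probability T R) (I : finType) (A : I -> R) (g : I -> T -> R) :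
    (forall t, mu.-integrable setT (EFin \o g t)) ->
  (\int[mu]_z (\big[Num.max/0]_t
      expR (A t + (fine (\int[mu]_z' (g t z')%:E) - g t z)))%:E <=
   \int[mu]_z (2^-1 * (\big[Num.max/0]_t expR (A t + 2 * g t z) +
      \big[Num.max/0]_t expR (A t - 2 * g t z)))%:E)%E.
Proof.
move=> ig.
have mg t : measurable_fun setT (g t).
  by apply/measurable_EFinP; exact: (measurable_int mu).
set U := fun z => \big[Num.max/0]_t expR (A t + 2 * g t z).
set V := fun z => \big[Num.max/0]_t expR (A t - 2 * g t z).
have mU : measurable_fun setT U.
  apply: measurable_bigmax => t; apply: measurableT_comp => //.
  by apply: measurable_funD => //; exact: measurable_funM.
have mV : measurable_fun setT V.
  apply: measurable_bigmax => t; apply: measurableT_comp => //.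
  by apply: measurable_funB => //; exact: measurable_funM.
have U0 z : 0 <= U z by exact: bigmax_ge_id.
have V0 z : 0 <= V z by exact: bigmax_ge_id.
have mU2 : measurable_fun setT (fun z => (2^-1 * U z)%:E).
  by apply/measurable_EFinP; exact: measurable_funM.
have mV2 : measurable_fun setT (fun z => (2^-1 * V z)%:E).
  by apply/measurable_EFinP; exact: measurable_funM.
have U20 z : (0 <= (2^-1 * U z)%:E)%E by rewrite lee_fin mulr_ge0.
have V20 z : (0 <= (2^-1 * V z)%:E)%E by rewrite lee_fin mulr_ge0.
(* The integral of U is a constant and can be placed inside the integral over z; the inequality is
   then proved for each z separately. *)
have -> : (\int[mu]_z (2^-1 * (U z + V z))%:E =
  \int[mu]_z (\int[mu]_z' (2^-1 * U z')%:E + (2^-1 * V z)%:E))%E.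
  under eq_integral do rewrite mulrDr EFinD.
  rewrite ge0_integralD// [RHS]ge0_integralD//; last by move=> _ _; apply: integral_ge0.
  by rewrite integral_probability_cst.
apply: ge0_le_integral => //.
- by move=> z _; rewrite lee_fin bigmax_ge_id.
- apply/measurable_EFinP/measurable_bigmax => t; apply: measurableT_comp => //.
  by apply: measurable_funD => //; exact: measurable_funB.
- by apply: emeasurable_funD.
move=> z _.
have -> : (\int[mu]_z' (2^-1 * U z')%:E + (2^-1 * V z)%:E =
   \int[mu]_z' ((2^-1 * U z')%:E + (2^-1 * V z)%:E))%E.
  by rewrite ge0_integralD// integral_probability_cst.
have [i _|I0] := pickP I; last first.
  by rewrite big_pred0//; apply: integral_ge0 => z' _; rewrite adde_ge0.
(* At fixed z the maximum is attained at one index t, to which Jensen's inequality in z' applies. *)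
have [t _ ->] := @eq_bigmax _ _ I 0 i xpredT (fun t => expR (A t +
   (fine (\int[mu]_z' (g t z')%:E) - g t z))) isT (fun t _ => expR_ge0 _).
set m := fine _.
rewrite (_ : A t + (m - g t z) = (A t - g t z) + m); last by ring.
rewrite expRD EFinM.
apply: (@le_trans _ _ ((expR (A t - g t z))%:E * \int[mu]_z' (expR (g t z'))%:E)%E).
  by apply: lee_wpmul2l; rewrite ?lee_fin ?expR_ge0//; exact: expR_jensen.
have mexp : measurable_fun setT (fun z => (expR (g t z))%:E).
  by apply/measurable_EFinP; exact: measurableT_comp.
rewrite -ge0_integralZl//.
apply: ge0_le_integral => //.
- exact: measurable_funeM.
- exact: emeasurable_funD.
move=> z' _; rewrite -EFinM -EFinD lee_fin -expRD -mulrDr.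
(* Splitting [A t] evenly yields, after doubling, the exponents A t + 2 g t z' and A t - 2 g t z. *)
rewrite (_ : _ + _ = (A t / 2 + g t z') + (A t / 2 - g t z)); last by field.
apply: (le_trans (expR_AM_GM _ _)).
rewrite ler_pM2l ?invr_gt0//; apply: lerD.
  rewrite (_ : 2 * _ = A t + 2 * g t z'); last by field.
  exact: (le_bigmax _ (fun t => expR (A t + 2 * g t z'))).
rewrite (_ : 2 * _ = A t - 2 * g t z); last by field.
exact: (le_bigmax _ (fun t => expR (A t - 2 * g t z))).
Qed.

(** * Independence of an observation from the earlier ones *)

(** The values on rectangles identify the law of (W, Y) as the product of the law of W and [mu];
    Tonelli's theorem then integrates Y out. *)
Lemma ge0_integral_indep (R : realType) (d d1 d2 : measure_display)
    (Om : measurableType d) (E : measurableType d1) (T : measurableType d2)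
    (P : probability Om R) (mu : probability T R)
    (W : {mfun Om >-> E}) (Y : {mfun Om >-> T}) (g : E * T -> \bar R) :
    (forall A B, measurable A -> measurable B ->
       P (W @^-1` A `&` Y @^-1` B) = P (W @^-1` A) * mu B)%E ->
    measurable_fun setT g -> (forall x, 0 <= g x)%E ->
  (\int[P]_w g (W w, Y w) = \int[P]_w \int[mu]_y g (W w, y))%E.
Proof.
move=> WY mg g0.
have mWY : measurable_fun setT (fun w => (W w, Y w)).
  by apply: measurable_fun_pair; exact: measurable_funP.
pose WYi := isMeasurableFun.Build _ _ _ _ _ mWY.
pose V : {mfun Om >-> (E * T)%type} := HB.pack (fun w => (W w, Y w)) WYi.
transitivity (\int[distribution P V]_z g z)%E.
  by rewrite ge0_integral_distribution.
transitivity (\int[distribution P W \x mu]_z g z)%E.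
  apply: eq_measure_integral => A mA _.
  by apply/esym/product_measure_unique => // B C mB mC; exact: WY.
rewrite fubini_tonelli1// ge0_integral_distribution//.
- exact: measurable_fun_fubini_tonelli_F.
- by move=> e; exact: integral_ge0.
Qed.

Section Sample.
Context {R : realType} {d d' : measure_display} {Om : measurableType d}
  {T : measurableType d'} {P : probability Om R} {mu : probability T R} {n : nat}.
Variable Zs : 'I_n -> {mfun Om >-> T}.
Hypothesis Zs_indep : mutually_independent P (fun i => Zs i : Om -> T).
Hypothesis Zs_law : forall i A, measurable A -> P (Zs i @^-1` A) = mu A.

(* A pi-system generating the sigma-algebra of the observations [Zs i], [i < k]. *)
Definition past (k : nat) : set (set Om) :=
  [set C | exists2 A : 'I_n -> set T, (forall i, measurable (A i)) &
    C = \bigcap_(i in [set i : 'I_n | (i < k)%N]) (Zs i @^-1` A i)].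

Local Notation OmegaPast k := (g_sigma_algebraType (past k)).

Lemma past_measurable k : past k `<=` measurable.
Proof.
move=> _ [A mA ->]; apply: fin_bigcap_measurable; first exact: finite_finset.
by move=> i _; exact: measurable_funPTI.
Qed.

Lemma past_setI_closed k : setI_closed (past k).
Proof.
move=> _ _ [A mA ->] [B mB ->]; exists (fun i => A i `&` B i).
  by move=> i; exact: measurableI.
rewrite -bigcapI; apply: eq_bigcapr => i _.
by rewrite preimage_setI.
Qed.

Lemma past_setT k : past k setT.
Proof.
exists (fun=> setT) => //; apply/esym/seteqP; split => // w _ i _ //.
Qed.

Lemma measurable_past k (i : 'I_n) : (i < k)%N ->
  measurable_fun [set: OmegaPast k] (Zs i : OmegaPast k -> T).
Proof.
move=> ik _ A mA; rewrite setTI; apply: sub_sigma_algebra.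
exists (fun j => if j == i then A else setT) => [j|]; first by case: ifP.
apply/seteqP; split => [w /= Aw j _|w /= /(_ i ik)] /=; last by rewrite eqxx.
by case: eqP => // ->.
Qed.

Lemma measurable_id_past k :
  measurable_fun [set: Om] (id : Om -> OmegaPast k).
Proof.
move=> _ A; rewrite setTI preimage_id.
apply: smallest_sub; first exact: sigma_algebra_measurable.
exact: past_measurable.
Qed.

(** Both sides are finite measures in E: P restricted to the event on [Zs k], and P scaled by
    [mu B]. Mutual independence makes them agree on the pi-system [past k], hence on the
    sigma-algebra it generates. *)
Lemma past_indep (k : 'I_n) (E : set Om) (B : set T) :
  <<s past k >> E -> measurable B ->
  (P (E `&` Zs k @^-1` B) = P E * mu B)%E.
Proof.
move=> sE mB.
have mZB : measurable (Zs k @^-1` B) by exact: measurable_funPTI.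
have muB0 : 0 <= fine (mu B) by rewrite fine_ge0.
transitivity (mscale (NngNum muB0) P E); last first.
  rewrite /mscale/= muleC fineK// fin_num_measure//.
rewrite -[LHS]/(mrestr P mZB E).
apply: (g_sigma_algebra_measure_unique (past k) _ (fun=> setT)) sE.
- exact: past_measurable.
- by move=> _; exact: past_setT.
- by apply: bigcup_const; exists 0%N.
- exact: past_setI_closed.
- move=> _ [A mA ->]; rewrite /mrestr/= /mscale/= fineK ?fin_num_measure//.
  pose J := [set i : 'I_n | (i < k)%N]%SET.
  have kJ : k \notin J by rewrite inE ltnn.
  (* With B placed at the index k, the intersection becomes an event of the family indexed by k and
     its predecessors. *)
  pose A' (i : 'I_n) := if i == k then B else A i.
  have mA' i : measurable (A' i) by rewrite /A'; case: ifP.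
  have JE : [set i : 'I_n | (i < k)%N] = [set` J].
    by apply/seteqP; split => i /=; rewrite inE.
  have AA' : \bigcap_(i in [set` J]) (Zs i @^-1` A i) =
             \bigcap_(i in [set` J]) (Zs i @^-1` A' i).
    apply: eq_bigcapr => i /= iJ; rewrite /A' ifN//.
    by apply: contraNneq kJ => <-.
  rewrite JE AA' (Zs_indep _ mA').
  transitivity (P (\bigcap_(i in [set` (k |: J)%SET]) (Zs i @^-1` A' i))).
    congr (P _); apply/seteqP; split => [w [Jw Bw] i /=|w Jw].
      rewrite !inE => /orP[/eqP ->|ik]; first by rewrite /A' eqxx.
      by apply: Jw; rewrite /= inE.
    split; first by move=> i /= iJ; apply: Jw; rewrite /= inE iJ orbT.
    by have := Jw k; rewrite /A' eqxx; apply; rewrite /= !inE eqxx.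
  rewrite Zs_indep// big_setU1//=.
  by rewrite Zs_law// /A' eqxx.
- move=> _; apply: (le_lt_trans (probability_le1 P _) (ltry _)).
  exact: measurableI.
Qed.

(** The past is represented by the identity map from Omega to Omega with the coarser sigma-algebra,
    so that a function of the past is just a function measurable for the latter. *)
Lemma ge0_integral_past (k : 'I_n) (g : OmegaPast k * T -> \bar R) :
    measurable_fun setT g -> (forall x, 0 <= g x)%E ->
  (\int[P]_w g (w, Zs k w) = \int[P]_w \int[mu]_z g (w, z))%E.
Proof.
move=> mg g0.
pose idm := isMeasurableFun.Build _ _ _ _ _ (@measurable_id_past k).
pose W : {mfun Om >-> OmegaPast k} := HB.pack (id : Om -> OmegaPast k) idm.
apply: (@ge0_integral_indep _ _ _ _ _ _ _ P mu W (Zs k)) => // A B mA mB.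
exact: past_indep.
Qed.

Lemma prod_past (k : 'I_n) (F : 'I_n -> R) :
  \prod_(i < n | (i < k.+1)%N) F i = F k * \prod_(i < n | (i < k)%N) F i.
Proof.
rewrite (bigD1 k)//=; congr (_ * _); apply: eq_bigl => i.
by rewrite ltnS andbC -ltn_neqAle.
Qed.

Lemma measurable_prod_past (k : nat) (phi : T -> R) :
  measurable_fun setT phi ->
  measurable_fun [set: OmegaPast k] (fun w => \prod_(i < n | (i < k)%N) phi (Zs i w)).
Proof.
move=> mphi.
under eq_fun do rewrite -big_filter.
apply: measurable_prod => i; rewrite mem_filter => /andP[ik _].
by apply: measurableT_comp => //; exact: measurable_past.
Qed.

(** Induction on the number of factors: the last observation is integrated out given the past and
    contributes a factor at most C. *)
Lemma integral_prod_le (phi : T -> R) (C : R) :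
    measurable_fun setT phi -> (forall z, 0 <= phi z) ->
    (\int[mu]_z (phi z)%:E <= C%:E)%E ->
  (\int[P]_w (\prod_(i < n) phi (Zs i w))%:E <= (C ^+ n)%:E)%E.
Proof.
move=> mphi phi0 phiC.
have C0 : 0 <= C.
  by rewrite -lee_fin; apply: le_trans phiC; apply: integral_ge0 => z _; rewrite lee_fin.
suff H k : (k <= n)%N ->
  (\int[P]_w (\prod_(i < n | (i < k)%N) phi (Zs i w))%:E <= (C ^+ k)%:E)%E.
  have := H n (leqnn n).
  by under eq_integral do [under eq_bigl do rewrite ltn_ord].
elim: k => [_|k IH kn].
  under eq_integral do rewrite big_pred0//.
  by rewrite integral_cst//= mul1e probability_setT.
pose K := Ordinal kn.
have prod0 j w : 0 <= \prod_(i < n | (i < j)%N) phi (Zs i w).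
  by apply: prodr_ge0 => i _; exact: phi0.
have mprod := @measurable_prod_past k _ mphi.
under eq_integral do rewrite (prod_past K).
pose g := fun x : OmegaPast k * T =>
  ((phi x.2)%:E * (\prod_(i < n | (i < k)%N) phi (Zs i x.1))%:E)%E.
have -> : (\int[P]_w (phi (Zs K w) * \prod_(i < n | (i < k)%N) phi (Zs i w))%:E =
  \int[P]_w g (w, Zs K w))%E by apply: eq_integral => w _; rewrite /g EFinM.
rewrite (ge0_integral_past (k := K)); last 2 first.
- apply: emeasurable_funM; apply/measurable_EFinP.
    exact: (measurableT_comp mphi measurable_snd).
  exact: (measurableT_comp mprod measurable_fst).
- by move=> x; rewrite /g -EFinM lee_fin mulr_ge0.
under eq_integral => w _.
  rewrite /g/= ge0_integralZr//; last 3 first.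
  - by apply/measurable_EFinP.
  - by move=> z _; rewrite lee_fin.
  - by rewrite lee_fin.
  over.
have mprodP : measurable_fun [set: Om] (fun w => (\prod_(i < n | (i < k)%N) phi (Zs i w))%:E).
  apply/measurable_EFinP.
  exact: (measurableT_comp mprod (@measurable_id_past k)).
rewrite ge0_integralZl//; last 2 first.
- by move=> w _; rewrite lee_fin.
- by apply: integral_ge0 => z _; rewrite lee_fin.
rewrite exprS EFinM; apply: lee_pmul => //.
- by apply: integral_ge0 => z _; rewrite lee_fin.
- by apply: integral_ge0 => z _; rewrite lee_fin.
- by apply: IH; exact: ltnW.
Qed.

End Sample.

(** * Exponential moments of the supremum over an l1-ball *)

Section SymmetrizedProcess.
Context {R : realType} {d d' : measure_display} {Om : measurableType d}
  {T : measurableType d'} {P : probability Om R} {mu : probability T R} {n : nat}.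
Variable Zs : 'I_n -> {mfun Om >-> T}.
Hypothesis Zs_indep : mutually_independent P (fun i => Zs i : Om -> T).
Hypothesis Zs_law : forall i A, measurable A -> P (Zs i @^-1` A) = mu A.

Context {M : nat} {I : finType}.
Variables (i0 : I) (j0 : 'I_M) (Delta : I -> 'I_M -> R) (g : I -> T -> R)
  (u : 'I_M -> T -> R) (delta C : R).
Hypothesis Delta_le : forall t, \sum_j `|Delta t j| <= delta.
Hypothesis ig : forall t, mu.-integrable setT (EFin \o g t).
Hypothesis um : forall j, measurable_fun setT (u j).
Let tau t z := \sum_j Delta t j * u j z.
Hypothesis g_tau : forall t z, `|2 * g t z| <= `|tau t z|.
Hypothesis gg_tau : forall t t' z,
  `|2 * g t z - 2 * g t' z| <= `|tau t z - tau t' z|.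
Hypothesis cosh_le : forall j,
  (\int[mu]_z (2^-1 * (expR (delta * u j z) + expR (- (delta * u j z))))%:E <= C%:E)%E.

Let mean t := fine (\int[mu]_z (g t z)%:E).
Let dev k t w := \sum_(i < n | (i < k)%N) (mean t - g t (Zs i w)).

Let mg t : measurable_fun setT (g t).
Proof. by apply/measurable_EFinP; exact: (measurable_int mu). Qed.

Let mdev k t : measurable_fun [set: g_sigma_algebraType (past Zs k)] (dev k t).
Proof.
rewrite /dev; under eq_fun do rewrite big_mkcond/=.
apply: measurable_sum => i; have [ik|_] := boolP (i < k)%N => //.
apply: measurable_funB => //; apply: measurableT_comp => //.
exact: measurable_past.
Qed.

(** A linear form on the l1-ball of radius delta is largest at one of the 2 M vertices, which are
    plus or minus delta times a unit vector; the sum over the vertices dominates the maximum. *)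
Lemma bigmax_linear_le (v : 'I_M -> R) :
  \big[Num.max/0]_t expR (\sum_j Delta t j * v j) <=
  \sum_j (expR (delta * v j) + expR (- (delta * v j))).
Proof.
have pos j : 0 <= expR (delta * v j) + expR (- (delta * v j)) by rewrite addr_ge0 ?expR_ge0.
apply: bigmax_le => [|t _]; first exact: sumr_ge0.
have [j _ jmax] := arg_maxP (fun j => `|v j|) (isT : xpredT j0).
have d0 : 0 <= delta by apply: le_trans (Delta_le t); exact: sumr_ge0.
apply: (@le_trans _ _ (expR (delta * `|v j|))).
  rewrite ler_expR; apply: (@le_trans _ _ ((\sum_k `|Delta t k|) * `|v j|)).
    rewrite mulr_suml; apply: ler_sum => k _.
    by rewrite (le_trans (ler_norm _))// normrM ler_wpM2l//; exact: jmax.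
  by rewrite ler_wpM2r.
rewrite (bigD1 j)//=; apply: ler_wpDr; first exact: sumr_ge0.
have [vj|vj] := leP 0 (v j).
  by rewrite ger0_norm// ler_wpDr ?expR_ge0.
by rewrite ltr0_norm// mulrN ler_wpDl ?expR_ge0.
Qed.

(** By cosh (x + y) + cosh (x - y) = 2 cosh x cosh y, averaging over the sign of the next
    observation costs a factor C and restores the summand without the shift. *)
Lemma cosh_integral_shift (x : R) j : 0 <= delta ->
  (\int[mu]_z (2^-1 * ((expR (x + delta * u j z) + expR (- (x + delta * u j z))) +
     (expR (x - delta * u j z) + expR (- (x - delta * u j z)))))%:E <=
   (C * (expR x + expR (- x)))%:E)%E.
Proof.
move=> d0.
have E z : 2^-1 * ((expR (x + delta * u j z) + expR (- (x + delta * u j z))) +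
     (expR (x - delta * u j z) + expR (- (x - delta * u j z)))) =
   (2^-1 * (expR (delta * u j z) + expR (- (delta * u j z)))) * (expR x + expR (- x)).
  by rewrite !opprD !expRD !opprK; ring.
under eq_integral do rewrite E EFinM.
have x0 : 0 <= expR x + expR (- x) by rewrite addr_ge0 ?expR_ge0.
rewrite ge0_integralZr//.
- rewrite EFinM; apply: lee_wpmul2r => //; exact: cosh_le.
- apply/measurable_EFinP; apply: measurable_funM => //.
  have mdu : measurable_fun setT (fun z => delta * u j z) by exact: measurable_funM.
  by apply: measurable_funD; apply: measurableT_comp => //; exact: measurableT_comp.
Qed.

(* With the first k observations frozen, the next one is symmetrized and
   contracted, which adds + u or - u to the linear form [v]; Tonelli's theorem
   makes this shift deterministic, so that the induction hypothesis, stated for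
   all [v], applies. *)
Lemma integral_bigmax_dev_le k (v : 'I_M -> R) : (k <= n)%N ->
  (\int[P]_w (\big[Num.max/0]_t expR (\sum_j Delta t j * v j + dev k t w))%:E <=
   (C ^+ k * \sum_j (expR (delta * v j) + expR (- (delta * v j))))%:E)%E.
Proof.
have d0 : 0 <= delta by apply: le_trans (Delta_le i0); exact: sumr_ge0.
have C0 : 0 <= C.
  rewrite -lee_fin; apply: le_trans (cosh_le j0); apply: integral_ge0 => z _.
  by rewrite lee_fin mulr_ge0// addr_ge0 ?expR_ge0.
elim: k v => [v _|k IH v kn].
  rewrite expr0 mul1r.
  have dev0 t w : dev 0 t w = 0 by rewrite /dev big_pred0.
  under eq_integral => w _.
    under eq_bigr do rewrite dev0 addr0.
    over.
  by rewrite integral_probability_cst lee_fin bigmax_linear_le.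
pose K := Ordinal kn.
pose G := fun x : g_sigma_algebraType (past Zs k) * T => \big[Num.max/0]_t
  expR ((\sum_j Delta t j * v j + dev k t x.1) + (mean t - g t x.2)).
(* In [H e] the new observation enters only through the linear form, with the sign (-1)^e, and the
   earlier ones only through [dev k]. *)
pose H (e : bool) := fun x : T * Om => \big[Num.max/0]_t
  expR (\sum_j Delta t j * (v j + (-1) ^+ e * u j x.1) + dev k t x.2).
have mdevP t : measurable_fun [set: Om] (dev k t).
  exact: (measurableT_comp (@mdev k t) (measurable_id_past (Zs := Zs) (k := k))).
have mH e : measurable_fun setT (H e).
  apply: measurable_bigmax => t; apply: measurableT_comp => //.
  apply: measurable_funD.
    apply: measurable_sum => j; apply: measurable_funM => //.
    apply: measurable_funD => //; apply: measurable_funM => //.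
    exact: (measurableT_comp (um j) measurable_fst).
  exact: (measurableT_comp (mdevP t) measurable_snd).
have H0 e x : 0 <= H e x by exact: bigmax_ge_id.
have -> : (\int[P]_w (\big[Num.max/0]_t expR (\sum_j Delta t j * v j + dev k.+1 t w))%:E
   = \int[P]_w (EFin \o G) (w, Zs K w))%E.
  apply: eq_integral => w _; rewrite /G/=; congr EFin; apply: eq_bigr => t _.
  congr expR; rewrite -addrA; congr (_ + _); rewrite /dev (bigD1 K)//= addrC.
  by congr (_ + _); apply: eq_bigl => i; rewrite ltnS andbC -ltn_neqAle.
rewrite (ge0_integral_past Zs_indep Zs_law); last 2 first.
- apply/measurable_EFinP/measurable_bigmax => t; apply: measurableT_comp => //.
  apply: measurable_funD.
    by apply: measurable_funD => //; exact: (measurableT_comp (@mdev k t) measurable_fst).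
  by apply: measurable_funB => //; exact: (measurableT_comp (mg t) measurable_snd).
- by move=> x; rewrite lee_fin bigmax_ge_id.
pose half x := (2^-1 * (H false x + H true x))%:E.
have mhalf : measurable_fun setT half.
  apply/measurable_EFinP; apply: measurable_funM => //; exact: measurable_funD.
have half0 x : (0 <= half x)%E by rewrite lee_fin mulr_ge0// addr_ge0.
have mhalf1 w : measurable_fun setT (fun z => half (z, w)).
  by apply: (measurableT_comp mhalf); exact: measurable_pair2.
apply: (@le_trans _ _ (\int[P]_w \int[mu]_z half (z, w))%E).
  apply: ge0_le_integral => //.
  - by move=> w _; apply: integral_ge0 => z _; rewrite lee_fin bigmax_ge_id.
  - have mGP : measurable_fun setT (fun x : Om * T => (EFin \o G) x).
      apply/measurable_EFinP/measurable_bigmax => t; apply: measurableT_comp => //.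
      apply: measurable_funD.
        by apply: measurable_funD => //; exact: (measurableT_comp (mdevP t) measurable_fst).
      by apply: measurable_funB => //; exact: (measurableT_comp (mg t) measurable_snd).
    by apply: (measurable_fun_fubini_tonelli_F _ mGP) => x; rewrite lee_fin bigmax_ge_id.
  - exact: (measurable_fun_fubini_tonelli_G _ mhalf half0).
  move=> w _.
  apply: (le_trans (symmetrization (fun t => \sum_j Delta t j * v j + dev k t w) ig)).
  apply: ge0_le_integral => //.
  - by move=> z _; rewrite lee_fin mulr_ge0// addr_ge0// bigmax_ge_id.
  - apply/measurable_EFinP; apply: measurable_funM => //; apply: measurable_funD.
      apply: measurable_bigmax => t; apply: measurableT_comp => //.
      by apply: measurable_funD => //; exact: measurable_funM.
    apply: measurable_bigmax => t; apply: measurableT_comp => //.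
    by apply: measurable_funB => //; exact: measurable_funM.
  move=> z _; rewrite lee_fin ler_pM2l ?invr_gt0//.
  apply: (le_trans (contraction i0 _ (fun t => g_tau t z) (fun t t' => gg_tau t t' z))).
  apply: lerD; rewrite le_eqVlt; apply/orP; left; apply/eqP; apply: eq_bigr => t _;
    congr expR; rewrite /tau addrAC; congr (_ + _).
    rewrite -big_split/=; apply: eq_bigr => j _.
    by rewrite expr0 mul1r mulrDr.
  rewrite -sumrB; apply: eq_bigr => j _.
  by rewrite expr1 mulN1r mulrBr.
rewrite -(fubini_tonelli (m1 := mu) (m2 := P) half mhalf half0).
pose S (x : R) := expR x + expR (- x).
apply: (@le_trans _ _ (\int[mu]_z \sum_j (C ^+ k *
   (2^-1 * (S (delta * v j + delta * u j z) + S (delta * v j - delta * u j z))))%:E)%E).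
  have S0 x : 0 <= S x by rewrite addr_ge0 ?expR_ge0.
  have mS : measurable_fun setT S.
    by apply: measurable_funD => //; apply: measurableT_comp.
  apply: ge0_le_integral => //.
  - by move=> z _; apply: integral_ge0.
  - exact: (measurable_fun_fubini_tonelli_F _ mhalf half0).
  - apply: emeasurable_sum => j; apply/measurable_EFinP.
    do 2 (apply: measurable_funM => //).
    apply: measurable_funD; apply: measurableT_comp => //.
      by apply: measurable_funD => //; exact: measurable_funM.
    by apply: measurable_funB => //; exact: measurable_funM.
  move=> z _.
  have mHz e : measurable_fun setT (fun w => H e (z, w)).
    by apply: (measurableT_comp (mH e)); exact: measurable_pair1.
  rewrite /half.
  under eq_integral do rewrite EFinM EFinD.
  rewrite ge0_integralZl//; last 2 first.
  - by apply: emeasurable_funD; apply/measurable_EFinP.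
  - by move=> w _; rewrite adde_ge0// lee_fin.
  rewrite ge0_integralD//; last 4 first.
  - by move=> w _; rewrite lee_fin.
  - by apply/measurable_EFinP.
  - by move=> w _; rewrite lee_fin.
  - by apply/measurable_EFinP.
  have IHz e := IH (fun j => v j + (-1) ^+ e * u j z) (ltnW kn).
  apply: (le_trans (lee_wpmul2l _ (leeD (IHz false) (IHz true)))).
    by rewrite lee_fin.
  rewrite -EFinD -EFinM sumEFin lee_fin le_eqVlt; apply/orP; left; apply/eqP.
  rewrite -mulrDr mulrCA -big_split/= !mulr_sumr; apply: eq_bigr => j _.
  by rewrite /S expr0 expr1 mul1r mulN1r (mulrDr delta) (mulrBr delta).
have mS : measurable_fun setT S.
  by apply: measurable_funD => //; apply: measurableT_comp.
have mSS j : measurable_fun setT (fun z =>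
    (2^-1 * (S (delta * v j + delta * u j z) + S (delta * v j - delta * u j z)))%:E).
  apply/measurable_EFinP; apply: measurable_funM => //.
  apply: measurable_funD; apply: measurableT_comp => //.
    by apply: measurable_funD => //; exact: measurable_funM.
  by apply: measurable_funB => //; exact: measurable_funM.
have SS0 j z : (0 <=
    (2^-1 * (S (delta * v j + delta * u j z) + S (delta * v j - delta * u j z)))%:E)%E.
  by rewrite lee_fin mulr_ge0// !addr_ge0 ?expR_ge0.
rewrite ge0_integral_sum//; last 2 first.
- move=> j; under eq_fun do rewrite EFinM; exact: measurable_funeM.
- by move=> j z _; rewrite EFinM mule_ge0// lee_fin exprn_ge0.
rewrite mulr_sumr -sumEFin; apply: lee_sum => j _.
under eq_integral do rewrite EFinM.
rewrite ge0_integralZl//; last by rewrite lee_fin exprn_ge0.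
rewrite exprSr -mulrA EFinM; apply: lee_wpmul2l; first by rewrite lee_fin exprn_ge0.
exact: cosh_integral_shift.
Qed.

(** Markov's inequality for the exponential of the maximal deviation. The linear form is taken to be
    0, so that every vertex contributes 1 and the sum over them is 2 M. *)
Lemma prob_exists_dev_le (x : R) :
  (P [set w | exists t, (x <= \sum_(i < n) (mean t - g t (Zs i w)))%R] <=
   (expR (- x) * (C ^+ n * (2 * M%:R)))%:E)%E.
Proof.
set A := [set w | _].
have devE t w : dev n t w = \sum_(i < n) (mean t - g t (Zs i w)).
  by apply: eq_bigl => i; rewrite ltn_ord.
have mdevP t : measurable_fun [set: Om] (dev n t).
  exact: (measurableT_comp (@mdev n t) (measurable_id_past (Zs := Zs) (k := n))).
have mmax : measurable_fun [set: Om]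
    (fun w => (expR (- x) * \big[Num.max/0]_t expR (dev n t w))%:E).
  apply/measurable_EFinP; apply: measurable_funM => //.
  by apply: measurable_bigmax => t; exact: measurableT_comp.
have mA : measurable A.
  rewrite (_ : A = \bigcup_(t in [set: I]) (dev n t @^-1` `[x, +oo[)).
    apply: fin_bigcup_measurable; first exact: finite_finset.
    by move=> t _; rewrite -[X in measurable X]setTI; exact: mdevP.
  apply/seteqP; split => [w [t xt]|w [t _ /=]].
    by exists t => //=; rewrite in_itv/= andbT devE.
  by rewrite in_itv/= andbT devE => xt; exists t.
rewrite -[X in P X]setIT -integral_indic//.
apply: (@le_trans _ _ (\int[P]_w (expR (- x) * \big[Num.max/0]_t expR (dev n t w))%:E)%E).
  apply: ge0_le_integral => //.
  - by apply/measurable_EFinP; exact: measurable_indic.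
  move=> w _; rewrite lee_fin indicE; have [|_] := boolP (w \in A); last first.
    by rewrite mulr_ge0 ?expR_ge0// bigmax_ge_id.
  rewrite inE => -[t xt].
  apply: (@le_trans _ _ (expR (- x) * expR (dev n t w))).
    by rewrite -expRD -[leLHS](expR0 R) ler_expR devE addrC subr_ge0.
  by rewrite ler_wpM2l ?expR_ge0//; exact: (le_bigmax _ (fun t => expR (dev n t w))).
under eq_integral do rewrite EFinM.
have mmax' : measurable_fun [set: Om] (fun w => (\big[Num.max/0]_t expR (dev n t w))%:E).
  by apply/measurable_EFinP; apply: measurable_bigmax => t; exact: measurableT_comp.
rewrite ge0_integralZl//; last by move=> w _; rewrite lee_fin bigmax_ge_id.
rewrite EFinM; apply: lee_wpmul2l; first by rewrite lee_fin expR_ge0.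
have v0 t w : \sum_j Delta t j * 0 + dev n t w = dev n t w.
  by rewrite big1 ?add0r// => j _; rewrite mulr0.
have := @integral_bigmax_dev_le n (fun=> 0) (leqnn n).
under [X in (_ <= (_ * X)%:E)%E]eq_bigr do rewrite mulr0 oppr0 expR0.
rewrite sumr_const card_ord => H; rewrite mulr_natr; apply: le_trans H.
rewrite le_eqVlt; apply/orP; left; apply/eqP; apply: eq_integral => w _.
by congr EFin; apply: eq_bigr => t _; congr expR; rewrite v0.
Qed.

End SymmetrizedProcess.

(** * Exponential bounds, difference quotients and the final algebra *)

Section RealAnalysis.
Context {R : realType}.
Implicit Types (x y u a : R) (g : R -> R).

Lemma expR_le_quad x : `|x| <= 1 -> expR x <= 1 + x + 2 * x ^+ 2.
Proof.
(* exp x <= (1 - x / 2)^-2, by the square of exp (- x / 2) >= 1 - x / 2. *)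
rewrite ler_norml => /andP[x1 x2].
have h : 0 < 1 - x / 2 by lra.
have e1 : expR (x / 2) * (1 - x / 2) <= 1.
  rewrite -[leRHS](expRxMexpNx_1 (x / 2)) ler_pM2l ?expR_gt0//.
  exact: expR_ge1Dx.
have e2 : expR x * (1 - x / 2) ^+ 2 <= 1.
  rewrite (_ : expR x = expR (x / 2) ^+ 2); last first.
    by rewrite expr2 -expRD; congr expR; field.
  by rewrite -exprMn exprn_ile1// mulr_ge0 ?expR_ge0// ltW.
rewrite -(@ler_pM2r _ ((1 - x / 2) ^+ 2)) ?exprn_gt0//; apply: (le_trans e2).
rewrite -subr_ge0 (_ : _ - _ = x ^+ 2 * ((1 - x) * (5 / 2 - x) / 2)); last by field.
by rewrite mulr_ge0 ?sqr_ge0// divr_ge0// mulr_ge0//; lra.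
Qed.

Lemma cosh_le_quad x : `|x| <= 1 -> 2^-1 * (expR x + expR (- x)) <= 1 + 2 * x ^+ 2.
Proof.
move=> x1; have := expR_le_quad x1; have := @expR_le_quad (- x).
by rewrite normrN sqrrN => /(_ x1); lra.
Qed.

(** Steps a / (k + 1) make the derivative a limit of a sequence, as measurability of limits and
    dominated convergence require. A vanishing a is treated apart because the derivative is a limit
    over nonzero steps. *)
Lemma diff_quotient_cvg g u a : derivable g u 1 ->
  k.+1%:R * (g (u + k.+1%:R^-1 * a) - g u) @[k --> \oo] --> a * derive1 g u.
Proof.
move=> dg.
have [->|a0] := eqVneq a 0.
  by under eq_fun do rewrite mulr0 addr0 subrr mulr0; rewrite mul0r; exact: cvg_cst.
have H : h^-1 * (g (h + u) - g u) @[h --> 0^'] --> derive1 g u.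
  rewrite derive1E; move: dg; rewrite /derivable /derive.
  by under eq_fun do rewrite -[_ *: 1]/(_ * 1) mulr1.
have {}H := (cvgr_dnbhsP _ _ _).1 H (fun k => k.+1%:R^-1 * a).
have : a * ((k.+1%:R^-1 * a)^-1 * (g (k.+1%:R^-1 * a + u) - g u)) @[k --> \oo] -->
    a * derive1 g u.
  apply: cvgM; first exact: cvg_cst.
  apply: H; split=> [k|]; first by rewrite mulf_neq0// invr_neq0// pnatr_eq0.
  by rewrite -[X in _ --> X](mul0r a); apply: cvgM; [exact: cvg_harmonic|exact: cvg_cst].
apply: cvg_trans; apply: near_eq_cvg; apply: nearW => k.
by rewrite invfM invrK mulrA mulrCA mulfV// mulr1 (addrC u).
Qed.

(** By convexity, the difference quotient from u towards v with parameter 1 / (k + 1) is at most g v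
    - g u; let k tend to infinity. *)
Lemma convex_tangent_le g u v : convex_function [set: R^o] g -> derivable g u 1 ->
  g u + derive1 g u * (v - u) <= g v.
Proof.
move=> cg dg; rewrite mulrC.
suff : (v - u) * derive1 g u <= g v - g u by lra.
apply: (cvgr_to_le (@diff_quotient_cvg g u (v - u) dg)).
apply: nearW => k.
have k0 : 0 <= k.+1%:R^-1 :> R by rewrite invr_ge0.
have k1 : k.+1%:R^-1 <= 1 :> R by rewrite invf_le1// ler1n.
have := cg (Itv01 k0 k1) v u; rewrite !inE => /(_ I I).
rewrite !convRE/= /unstable.onem => H.
have {}H : g (k.+1%:R^-1 *: (v : R^o) + (1 - k.+1%:R^-1) *: (u : R^o)) <=
  k.+1%:R^-1 * g v + (1 - k.+1%:R^-1) * g u := H.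
rewrite -ler_pdivlMl//.
rewrite (_ : u + _ = k.+1%:R^-1 *: (v : R^o) + (1 - k.+1%:R^-1) *: (u : R^o)).
  by move: H; rewrite mulrBl mul1r mulrBr addrCA -lerBlDl.
by rewrite -[RHS]/(k.+1%:R^-1 * v + (1 - k.+1%:R^-1) * u); ring.
Qed.

Lemma lipschitz_derive_le g y :
  (forall x x', `|g x - g x'| <= `|x - x'|) -> derivable g y 1 -> `|derive1 g y| <= 1.
Proof.
move=> gL dg.
have /cvg_norm := @diff_quotient_cvg g y 1 dg; rewrite mul1r => H.
apply: (cvgr_to_le H).
apply: nearW => k; rewrite normrM ger0_norm// -ler_pdivlMl//.
by rewrite (le_trans (gL _ _))// addrC addKr mulr1 ger0_norm ?invr_ge0// mulr1.
Qed.

Lemma mvt_lipschitz g D : (forall x, derivable g x 1) -> (forall x, `|derive1 g x| <= D) ->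
  forall x y, `|g x - g y| <= D * `|x - y|.
Proof.
move=> dg gD x y; wlog xy : x y / x <= y.
  by move=> H; have [|/ltW] := leP x y; [|rewrite distrC (distrC x)]; exact: H.
have [||c _] := @MVT_segment _ g (derive1 g) x y xy.
- by move=> z _; rewrite derive1E; apply: derivableP.
- apply: derivable_within_continuous => z _; exact: dg.
rewrite distrC => ->; rewrite normrM (distrC x).
by rewrite ler_wpM2r.
Qed.

(** Young's inequality with the conjugate exponents p = kappa / (kappa - 1) and kappa splits off a
    fraction 1 / kappa of the quantity to be bounded, which is absorbed on the left because p (1 - 1
    / kappa) = 1. *)
Lemma oracle_algebra (E l A r rt K kappa : R) :
  0 <= E -> 0 <= A -> 0 < r -> 0 <= rt -> 1 <= K -> 1 < kappa ->
  l <= A * E `^ kappa^-1 -> E <= (1 + 2 * K) * r * l + 2 * r * rt ->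
  E <= ((1 + 2 * K) * r * A) `^ (kappa / (kappa - 1)) + kappa / (kappa - 1) * (2 * r * rt) /\
  l <= A `^ (kappa / (kappa - 1)) * ((1 + 2 * K) * r) `^ (kappa - 1)^-1 +
    2 * K / ((kappa - 1) * (1 + 2 * K)) * rt.
Proof.
move=> E0 A0 r0 rt0 K1 k1 lA EB.
set p := kappa / (kappa - 1).
have k0 : 0 < kappa by lra.
have km0 : 0 < kappa - 1 by lra.
have p0 : 0 < p by rewrite divr_gt0.
have pk : p^-1 + kappa^-1 = 1.
  by rewrite /p; field; rewrite !gt_eqF.
have B0 : 0 < (1 + 2 * K) * r by apply: mulr_gt0 => //; lra.
have young a : 0 <= a -> forall b, 0 <= b -> a * b `^ kappa^-1 <= a `^ p / p + b / kappa.
  move=> a0 b b0.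
  have := conjugate_powR a0 (powR_ge0 b kappa^-1) p0 k0 pk.
  by rewrite -powRrM mulVf ?gt_eqF// powRr1.
have pm : p * (1 - kappa^-1) = 1 by rewrite -pk addrK mulfV ?gt_eqF.
split.
  have yE := young _ (mulr_ge0 (ltW B0) A0) _ E0.
  have EB' : E <= (1 + 2 * K) * r * A * E `^ kappa^-1 + 2 * r * rt.
    by apply: (le_trans EB); rewrite lerD2r -[leRHS]mulrA ler_pM2l.
  have : E * (1 - kappa^-1) <= ((1 + 2 * K) * r * A) `^ p / p + 2 * r * rt.
    by rewrite mulrBr mulr1; lra.
  rewrite -(ler_pM2l p0) mulrCA pm mulr1 => /le_trans; apply.
  by rewrite mulrDr mulrCA mulfV ?gt_eqF// mulr1.
set B := (1 + 2 * K) * r in B0 EB *.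
have [l0|l0] := leP l 0.
  apply: (le_trans l0); apply: addr_ge0; first by rewrite mulr_ge0 ?powR_ge0.
  by rewrite mulr_ge0// divr_ge0// ?mulr_ge0//; lra.
(* With this q the bound on E reads B (l + q), so that E can be eliminated from the bound on l. *)
set q := 2 * r * rt / B.
have q0 : 0 <= q by apply: divr_ge0; [rewrite !mulr_ge0// ltW|exact: ltW].
have EB' : E <= B * (l + q) by rewrite mulrDr mulrCA mulfV ?gt_eqF// mulr1.
have lq : 0 <= l + q by rewrite addr_ge0// ltW.
have step : l <= A * B `^ kappa^-1 * (l + q) `^ kappa^-1.
  apply: (le_trans lA); rewrite -mulrA -powRM ?(ltW B0)//.
  apply: ler_wpM2l => //; apply: ge0_ler_powR => //; rewrite ?nnegrE ?invr_ge0 ?(ltW k0)//.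
  by rewrite mulr_ge0// ltW.
have AB0 : 0 <= A * B `^ kappa^-1 by rewrite mulr_ge0 ?powR_ge0.
have yl := young _ AB0 _ lq.
have : l * (1 - kappa^-1) <= (A * B `^ kappa^-1) `^ p / p + q / kappa.
  by rewrite mulrBr mulr1; move: (le_trans step yl); rewrite (mulrDl l q); lra.
rewrite -(ler_pM2l p0) mulrCA pm mulr1 => /le_trans; apply.
rewrite mulrDr mulrCA mulfV ?gt_eqF// mulr1; apply: lerD.
  rewrite powRM ?powR_ge0// -powRrM le_eqVlt; apply/orP; left; apply/eqP.
  by congr (_ * _ `^ _); rewrite /p; field; rewrite !gt_eqF.
rewrite /q /B /p.
have K2 : 0 < 1 + 2 * K by lra.
(* The coefficient comes out as 2 / ((kappa - 1) (1 + 2 K)), and K >= 1 gives the stated one. *)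
rewrite (_ : _ * _ = 2 / ((kappa - 1) * (1 + 2 * K)) * rt); last first.
  by field; rewrite !gt_eqF.
apply: ler_wpM2r => //; rewrite ler_pM2r ?invr_gt0 ?mulr_gt0//; lra.
Qed.

End RealAnalysis.

(** * Moment generating functions of bounded functions with second moment at most 1 *)

Section MomentGenerating.
Context {R : realType} {d : measure_display} {T : measurableType d}
  (mu : probability T R).
Variables (phi : T -> R) (L s : R).
Hypothesis mphi : measurable_fun setT phi.
Hypothesis phi_L : {ae mu, forall z, `|phi z| <= L}.
Hypotheses (s0 : 0 <= s) (sL : s * L <= 1).
Hypothesis phi2 : (\int[mu]_z (phi z ^+ 2)%:E <= 1)%E.

Let sphi_le1 : {ae mu, forall z, `|s * phi z| <= 1}.
Proof.
apply: filterS phi_L => z zL; rewrite normrM ger0_norm//.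
by apply: le_trans sL; exact: ler_wpM2l.
Qed.

Let mphi2 : measurable_fun setT (fun z => (phi z ^+ 2)%:E).
Proof. by apply/measurable_EFinP; exact: measurable_funX. Qed.

Let msphi : measurable_fun setT (fun z => s * phi z).
Proof. exact: measurable_funM. Qed.

Let phi2_ge0 z : (0 <= (phi z ^+ 2)%:E)%E.
Proof. by rewrite lee_fin sqr_ge0. Qed.

Let s2_ge0 : (0 <= (2 * s ^+ 2)%:E)%E.
Proof. by rewrite lee_fin mulr_ge0 ?sqr_ge0. Qed.

Let quad_ge0 z : (0 <= (2 * s ^+ 2)%:E * (phi z ^+ 2)%:E)%E.
Proof. exact: mule_ge0. Qed.

Let mquad : measurable_fun setT (fun z => ((2 * s ^+ 2)%:E * (phi z ^+ 2)%:E)%E).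
Proof. exact: measurable_funeM. Qed.

Let int_quad_le : (1 + (2 * s ^+ 2)%:E * \int[mu]_z (phi z ^+ 2)%:E <=
  (expR (2 * s ^+ 2))%:E)%E.
Proof.
apply: (@le_trans _ _ (1 + (2 * s ^+ 2)%:E * 1)%E).
  by apply: leeD => //; apply: lee_wpmul2l => //.
by rewrite mule1 -EFinD lee_fin expR_ge1Dx.
Qed.

(** Since s L <= 1, |s phi| <= 1 almost everywhere, and there cosh x <= 1 + 2 x^2; then the second
    moment is at most 1, and 1 + x <= exp x. *)
Lemma integral_cosh_le :
  (\int[mu]_z (2^-1 * (expR (s * phi z) + expR (- (s * phi z))))%:E <=
   (expR (2 * s ^+ 2))%:E)%E.
Proof.
apply: le_trans int_quad_le.
have -> : (1 + (2 * s ^+ 2)%:E * \int[mu]_z (phi z ^+ 2)%:E =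
    \int[mu]_z (1 + (2 * s ^+ 2)%:E * (phi z ^+ 2)%:E))%E.
  by rewrite ge0_integralD// integral_probability_cst ge0_integralZl.
apply: ae_ge0_le_integral => //.
- apply/measurable_EFinP; apply: measurable_funM => //; apply: measurable_funD.
    exact: measurableT_comp.
  by apply: measurableT_comp => //; exact: measurableT_comp.
- by move=> z _; rewrite adde_ge0.
- exact: emeasurable_funD.
apply: filterS sphi_le1 => z z1 _; rewrite -EFinM -EFinD lee_fin.
by apply: (le_trans (cosh_le_quad z1)); rewrite exprMn mulrA.
Qed.

Lemma integrable_sqr_le1 : mu.-integrable setT (fun z => (phi z ^+ 2)%:E).
Proof.
apply/integrableP; split => //.
under eq_integral do rewrite gee0_abs ?lee_fin ?sqr_ge0//.
by apply: (le_lt_trans phi2); exact: ltry.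
Qed.

Lemma integrable_ae_bounded : mu.-integrable setT (EFin \o phi).
Proof.
have mEphi : measurable_fun setT (EFin \o phi) by exact/measurable_EFinP.
apply/integrableP; split => //.
have L0 z : (0 <= `|L|%:E)%E by rewrite lee_fin.
apply: (@le_lt_trans _ _ (\int[mu]_z `|L|%:E)%E); last first.
  by rewrite integral_probability_cst ltry.
apply: ae_ge0_le_integral => //; first exact: measurableT_comp.
by apply: filterS phi_L => z zL _ /=; rewrite lee_fin (le_trans zL)// ler_norm.
Qed.

(** As for the hyperbolic cosine, with a linear term that vanishes because phi is centred. *)
Lemma integral_expR_le : (\int[mu]_z (phi z)%:E = 0)%E ->
  (\int[mu]_z (expR (s * phi z))%:E <= (expR (2 * s ^+ 2))%:E)%E.
Proof.
move=> phi0; apply: le_trans int_quad_le.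
have iphi := integrable_ae_bounded; have iphi2 := integrable_sqr_le1.
have -> : (1 + (2 * s ^+ 2)%:E * \int[mu]_z (phi z ^+ 2)%:E =
    \int[mu]_z ((1 + s%:E * (phi z)%:E) + (2 * s ^+ 2)%:E * (phi z ^+ 2)%:E))%E.
  have i1 : mu.-integrable setT (fun z => (1 + s%:E * (phi z)%:E)%E).
    apply: integrableD => //; first exact: finite_measure_integrable_cst.
    exact: integrableZl.
  rewrite integralD//; last exact: integrableZl.
  rewrite integralD//; [|exact: finite_measure_integrable_cst|exact: integrableZl].
  by rewrite integral_probability_cst !integralZl// phi0 mule0 adde0.
(* The comparison of integrals asks for a majorant nonnegative at every point, while |s phi| <= 1
   holds only almost everywhere; hence the completed square. *)
have quad0 z : 0 <= 1 + s * phi z + 2 * s ^+ 2 * (phi z) ^+ 2.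
  rewrite (_ : _ + _ = (2 * s * phi z + 2^-1) ^+ 2 / 2 + 7 / 8); last by field.
  by rewrite addr_ge0// divr_ge0// ?sqr_ge0.
apply: ae_ge0_le_integral => //.
- by apply/measurable_EFinP; exact: measurableT_comp.
- by move=> z _; rewrite -!EFinM -!EFinD lee_fin.
- apply: emeasurable_funD => //.
  by apply: emeasurable_funD => //; apply: measurable_funeM; exact/measurable_EFinP.
apply: filterS sphi_le1 => z z1 _; rewrite -!EFinM -!EFinD lee_fin.
by apply: (le_trans (expR_le_quad z1)); rewrite exprMn mulrA.
Qed.

End MomentGenerating.

(** * Chernoff bounds for single sums and for sequences of functions *)

Section Deviations.
Context {R : realType} {d d' : measure_display} {Om : measurableType d}
  {T : measurableType d'} {P : probability Om R} {mu : probability T R} {n : nat}.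
Variable Zs : 'I_n -> {mfun Om >-> T}.
Hypothesis Zs_indep : mutually_independent P (fun i => Zs i : Om -> T).
Hypothesis Zs_law : forall i A, measurable A -> P (Zs i @^-1` A) = mu A.

Lemma measurable_sum_sample (phi : T -> R) : measurable_fun setT phi ->
  measurable_fun setT (fun w => \sum_(i < n) phi (Zs i w)).
Proof.
by move=> mphi; apply: measurable_sum => i; apply: measurableT_comp.
Qed.

Lemma measurable_sum_sample_ge (phi : T -> R) (x : R) : measurable_fun setT phi ->
  measurable [set w | x <= \sum_(i < n) phi (Zs i w)].
Proof.
move=> mphi; have := measurable_sum_sample mphi measurableT (measurable_itv `[x, +oo[).
by rewrite setTI; congr measurable; apply/seteqP; split => w /=; rewrite in_itv/= andbT.
Qed.

Lemma chernoff_sample (phi : T -> R) (s C x : R) : measurable_fun setT phi ->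
  0 <= s -> (\int[mu]_z (expR (s * phi z))%:E <= C%:E)%E ->
  (P [set w | (x <= \sum_(i < n) phi (Zs i w))%R] <= (expR (- (s * x)) * C ^+ n)%:E)%E.
Proof.
move=> mphi s0 HC; set A := [set w | _].
have mA : measurable A by exact: measurable_sum_sample_ge.
have mprod : measurable_fun setT (fun w => (\prod_(i < n) expR (s * phi (Zs i w)))%:E).
  apply/measurable_EFinP; apply: measurable_prod => i _; apply: measurableT_comp => //.
  by apply: measurable_funM => //; exact: measurableT_comp.
have prod0 w : (0 <= (\prod_(i < n) expR (s * phi (Zs i w)))%:E)%E.
  by rewrite lee_fin; apply: prodr_ge0 => i _; exact: expR_ge0.
rewrite -[X in P X]setIT -integral_indic//.
apply: (@le_trans _ _ (\int[P]_w ((expR (- (s * x)))%:E *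
    (\prod_(i < n) expR (s * phi (Zs i w)))%:E))%E).
  apply: ge0_le_integral => //.
  - by apply/measurable_EFinP; exact: measurable_indic.
  - exact: measurable_funeM.
  move=> w _; rewrite indicE; have [|_] := boolP (w \in A); last first.
    by rewrite mule_ge0// lee_fin expR_ge0.
  rewrite inE /A/= => xw; rewrite -EFinM lee_fin -expR_sum -expRD.
  by rewrite -[leLHS](expR0 R) ler_expR -mulr_sumr addrC subr_ge0 ler_wpM2l.
rewrite ge0_integralZl//.
rewrite EFinM; apply: lee_wpmul2l; first by rewrite lee_fin expR_ge0.
apply: (integral_prod_le Zs_indep Zs_law (phi := fun z => expR (s * phi z))) => //.
by apply: measurableT_comp => //; exact: measurable_funM.
Qed.

(** The bound for finite families does not depend on their size, so it passes to a sequence by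
    continuity of P along the increasing events of the first m + 1 indices. *)
Lemma prob_exists_dev_nat_le (M : nat) (j0 : 'I_M) (Delta : nat -> 'I_M -> R)
    (g : nat -> T -> R) (u : 'I_M -> T -> R) (delta C x : R)
    (A := [set w | exists t, x <=
      \sum_(i < n) (fine (\int[mu]_z (g t z)%:E)%E - g t (Zs i w))]) :
    (forall t, \sum_j `|Delta t j| <= delta) ->
    (forall t, mu.-integrable setT (EFin \o g t)) ->
    (forall j, measurable_fun setT (u j)) ->
    (forall t z, `|2 * g t z| <= `|\sum_j Delta t j * u j z|) ->
    (forall t t' z, `|2 * g t z - 2 * g t' z| <=
      `|\sum_j Delta t j * u j z - \sum_j Delta t' j * u j z|) ->
    (forall j, (\int[mu]_z (2^-1 * (expR (delta * u j z) +
      expR (- (delta * u j z))))%:E <= C%:E)%E) ->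
  measurable A /\ (P A <= (expR (- x) * (C ^+ n * (2 * M%:R)))%:E)%E.
Proof.
move=> D_le ig um g_tau gg_tau cosh_le.
pose a t z := fine (\int[mu]_z (g t z)%:E)%E - g t z.
have ma t : measurable_fun setT (a t).
  apply: measurable_funB => //; apply/measurable_EFinP.
  exact: (measurable_int mu).
pose B m := [set w | exists t : 'I_m.+1, x <= \sum_(i < n) a t (Zs i w)].
have mB m : measurable (B m).
  rewrite (_ : B m = \bigcup_(t in [set: 'I_m.+1])
      [set w | x <= \sum_(i < n) a t (Zs i w)]).
    apply: fin_bigcup_measurable; first exact: finite_finset.
    by move=> t _; exact: measurable_sum_sample_ge.
  by apply/seteqP; split => [w [t xt]|w [t _ xt]]; exists t.
have AB : A = \bigcup_m B m.
  apply/seteqP; split => [w [t xt]|w [m _ [t xt]]]; last by exists t.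
  by exists t => //; exists ord_max.
have mA : measurable A by rewrite AB; exact: bigcup_measurable.
split => //.
have cvgB : P (B m) @[m --> \oo] --> P A.
  rewrite AB; apply: nondecreasing_cvg_mu => //; first by rewrite -AB.
  move=> m m' mm'; apply/subsetPset => w [t xt].
  have tm' : (t < m'.+1)%N by rewrite (leq_trans (ltn_ord t)).
  by exists (Ordinal tm').
rewrite -(cvg_lim _ cvgB)//; apply: lime_le; first by apply/cvg_ex; exists (P A).
apply: nearW => m.
apply: (@prob_exists_dev_le _ _ _ _ _ P mu n Zs Zs_indep Zs_law M 'I_m.+1 ord0 j0
  (fun t => Delta t) (fun t => g t) u delta C) => //.
Qed.

End Deviations.

(** * The loss and its increments under the law of an observation *)

Section Loss.
Context {R : realType} {YT : Type} (gamma : YT -> R -> R).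
Hypothesis hglip : forall y u u', `|gamma y u - gamma y u'| <= `|u - u'|.
Hypothesis hgdiff : forall y u, derivable (gamma y) u 1.

(** The Lipschitz constant 1 bounds all the derivatives, so [dsup] is a true supremum and not a
    default value of [sup]. *)
Lemma le_dsup y u : `|derive1 (gamma y) u| <= dsup gamma.
Proof.
apply: ub_le_sup; last by exists (y, u).
by exists 1 => _ [[y' u'] _ <-]/=; apply: lipschitz_derive_le.
Qed.

Lemma dsup_lipschitz y u u' : `|gamma y u - gamma y u'| <= dsup gamma * `|u - u'|.
Proof. by apply: mvt_lipschitz => // x; exact: le_dsup. Qed.

End Loss.

Section Model.
Context {R : realType} {d dX dY : measure_display} {Om : measurableType d}
  {XT : measurableType dX} {YT : measurableType dY} {P : probability Om R}
  {M : nat} {Z : {RV P >-> (XT * YT)%type}} {f : 'I_M -> XT -> R}.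
Hypothesis hfmeas : forall j, measurable_fun [set: XT] (f j).

Local Notation mu := (distribution P Z).

Lemma fsumB theta theta' x : fsum f theta x - fsum f theta' x = fsum f (theta - theta') x.
Proof. by rewrite /fsum -sumrB; apply: eq_bigr => j _; rewrite !mxE mulrBl. Qed.

Lemma fsum_norm_le theta x : `|fsum f theta x| <= \sum_j `|theta 0 j| * `|f j x|.
Proof.
by apply: (le_trans (ler_norm_sum _ _ _)); apply: ler_sum => j _; rewrite normrM.
Qed.

Lemma measurable_fsum theta : measurable_fun [set: XT] (fsum f theta).
Proof. by apply: measurable_sum => j; exact: measurable_funM. Qed.

Lemma ae_law_fst (Q : XT -> Prop) : {ae lawX Z, forall x, Q x} ->
  {ae mu, forall z, Q z.1}.
Proof.
move=> [N [mN N0 QN]]; exists (fst @^-1` N); split.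
- by rewrite -[X in measurable X]setTI; exact: measurable_fst.
- exact: N0.
- by move=> z /= nQ; apply: QN.
Qed.

Lemma ae_normoo_le (g : XT -> R) (K : R) : (normoo (lawX Z) g <= K%:E)%E ->
  {ae mu, forall z, `|g z.1| <= K}.
Proof.
(* The norm of exponent +oo is the essential supremum provided that the whole space has positive
   measure. *)
rewrite /normoo unlock ifT => [/ess_supP H|]; last first.
  by rewrite [X in (0 < X)%E](_ : _ = 1%E) ?lte01//; exact: (probability_setT (lawX Z)).
by apply: (@ae_law_fst (fun x => `|g x| <= K)); apply: filterS H => x /=; rewrite lee_fin.
Qed.

Lemma integral_sqr_dict j : 'N[lawX Z]_2%:E[EFin \o f j]%E = 1%E ->
  (\int[mu]_z (f j z.1 ^+ 2)%:E = 1)%E.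
Proof.
move=> f1.
have m2 : measurable_fun [set: XT] (fun x => (f j x ^+ 2)%:E).
  by apply/measurable_EFinP; exact: measurable_funX.
have m2' : measurable_fun [set: XT * YT] (fun z => (f j z.1 ^+ 2)%:E).
  exact: (measurableT_comp m2 measurable_fst).
have sq0 x : (0 <= (f j x ^+ 2)%:E)%E by rewrite lee_fin sqr_ge0.
rewrite ge0_integral_distribution//.
transitivity (\int[lawX Z]_x (f j x ^+ 2)%:E)%E.
  by rewrite ge0_integral_distribution.
have := @powR_Lnorm _ _ _ (lawX Z) (EFin \o f j) 2 (lt0r_neq0 (ltr0Sn _ 1)).
rewrite f1 poweR1r => /esym E1; apply: (etrans _ E1); apply: eq_integral => x _ /=.
by rewrite -[RHS]/((`|f j x| `^ 2)%:E) powR_mulrn// real_normK ?num_real.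
Qed.


Variable (gamma : YT -> R -> R).
Hypothesis hgmeas : measurable_fun [set: YT * R] (fun yu => gamma yu.1 yu.2).
Hypothesis hglip : forall y u u', `|gamma y u - gamma y u'| <= `|u - u'|.
Hypothesis hgdiff : forall y u, derivable (gamma y) u 1.
Hypothesis hgint : forall theta : 'rV[R]_M,
  P.-integrable [set: Om] (EFin \o (fun w => Qloss gamma f (Z w) theta)).

Local Notation Q := (Qloss gamma f).
Local Notation D := (dsup gamma).
Local Notation risk := (risk gamma f P Z).

Lemma measurable_Qloss theta : measurable_fun [set: XT * YT] (Q ^~ theta).
Proof.
apply: (measurableT_comp (f := fun yu => gamma yu.1 yu.2)
  (g := fun z : XT * YT => (z.2, fsum f theta z.1))) => //.
apply: measurable_fun_pair; first exact: measurable_snd.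
exact: (measurableT_comp (@measurable_fsum theta) measurable_fst).
Qed.

Lemma integrable_Qloss theta : mu.-integrable setT (EFin \o Q ^~ theta).
Proof.
apply: integrable_pushforward => //; last exact: hgint.
by apply/measurable_EFinP; exact: measurable_Qloss.
Qed.

Lemma risk_integral theta : (\int[mu]_z (Q z theta)%:E = (risk theta)%:E)%E.
Proof.
transitivity (\int[P]_w (Q (Z w) theta)%:E)%E.
  apply: (integral_distribution (f := fun z => (Q z theta)%:E)); last exact: hgint.
  by apply/measurable_EFinP; exact: measurable_Qloss.
by rewrite /risk /Defs.risk unlock fineK//; exact: integrable_fin_num (hgint theta).
Qed.

Definition dQ (theta Delta : 'rV[R]_M) (z : XT * YT) : R := Q z (theta + Delta) - Q z theta.

Lemma integrable_dQ theta Delta : mu.-integrable setT (EFin \o dQ theta Delta).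
Proof.
exact: (integrableB measurableT (integrable_Qloss (theta + Delta)) (integrable_Qloss theta)).
Qed.

Lemma integral_dQ theta Delta :
  (\int[mu]_z (dQ theta Delta z)%:E = (risk (theta + Delta) - risk theta)%:E)%E.
Proof.
rewrite EFinB -!risk_integral -integralB//; exact: integrable_Qloss.
Qed.

Lemma dQ_lipschitz theta Delta Delta' z :
  `|dQ theta Delta z - dQ theta Delta' z| <= D * `|fsum f (Delta - Delta') z.1|.
Proof.
rewrite /dQ opprB addrA subrK; apply: (le_trans (dsup_lipschitz hglip hgdiff _ _ _)).
by rewrite fsumB opprD addrACA subrr add0r.
Qed.

Lemma dQ_norm_le theta Delta z : `|dQ theta Delta z| <= D * `|fsum f Delta z.1|.
Proof.
rewrite /dQ; apply: (le_trans (dsup_lipschitz hglip hgdiff _ _ _)).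
by rewrite fsumB addrC addKr.
Qed.

End Model.

(** * Gradient of the empirical risk *)

Lemma coord_le_norm {R : realType} {M : nat} (g : 'rV[R]_M) j : `|g 0 j| <= `|g|.
Proof.
by rewrite [leRHS]mx_normrE; exact: (le_bigmax _ (fun ij => `|g ij.1 ij.2|) (ord0, j)).
Qed.

Lemma norm_le_coord {R : realType} {M : nat} (g : 'rV[R]_M) (r : R) : 0 <= r ->
  (forall j, `|g 0 j| <= r) -> `|g| <= r.
Proof.
move=> r0 gr; rewrite [leLHS]mx_normrE; apply: bigmax_le => // -[i j] _ /=.
by rewrite ord1.
Qed.

(** Both sides are limits of the same difference quotient; this brings partial derivatives within
    reach of one-variable calculus. *)
Lemma derive_along_line {R : realType} {M : nat} (F : 'rV[R]_M -> R) theta v :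
  'D_v F theta = 'D_1 (fun h : R => F (h *: v + theta)) 0.
Proof.
pose q1 (h : R) := h^-1 *: ((F \o shift theta) (h *: v) - F theta).
pose Phi (h : R) := F (h *: v + theta).
pose q2 (h : R) := h^-1 *: ((Phi \o shift 0) (h *: 1) - Phi 0).
have E : q1 = q2.
  apply/funext => h; rewrite /q1 /q2 /Phi /= addr0 scale0r add0r.
  by rewrite -[h *: 1]/(h * 1) mulr1.
by rewrite -[LHS]/(lim (q1 @ 0^')) E.
Qed.

Section Gradient.
Context {R : realType} {dX dY : measure_display}
  {XT : measurableType dX} {YT : measurableType dY} {M : nat}
  {f : 'I_M -> XT -> R} {gamma : YT -> R -> R}.
Hypothesis hgconv : forall y, convex_function [set: R^o] (gamma y).
Hypothesis hgdiff : forall y u, derivable (gamma y) u 1.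

(** The partial derivative of [Qloss] in the coordinate j, by the chain rule. *)
Definition dloss (theta : 'rV[R]_M) (j : 'I_M) (z : XT * YT) : R :=
  derive1 (gamma z.2) (fsum f theta z.1) * f j z.1.

Lemma fsum_add_coord theta t j x :
  fsum f (t *: delta_mx 0 j + theta) x = fsum f theta x + t * f j x.
Proof.
rewrite addrC; transitivity (\sum_k (theta 0 k * f k x + (t * (k == j)%:R) * f k x)).
  by apply: eq_bigr => k _; rewrite !mxE eqxx/= mulrDl.
rewrite big_split/=; congr (_ + _); rewrite (bigD1 j)//= eqxx mulr1 big1 ?addr0// => k kj.
by rewrite (negbTE kj) mulr0 mul0r.
Qed.

Lemma convex_loss_le theta theta' (z : XT * YT) :
  gamma z.2 (fsum f theta z.1) - gamma z.2 (fsum f theta' z.1) <=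
  \sum_j dloss theta j z * (theta - theta') 0 j.
Proof.
have := @convex_tangent_le _ _ _ (fsum f theta' z.1) (@hgconv z.2)
  (@hgdiff z.2 (fsum f theta z.1)).
have -> : \sum_j dloss theta j z * (theta - theta') 0 j =
    derive1 (gamma z.2) (fsum f theta z.1) * (fsum f theta z.1 - fsum f theta' z.1).
  rewrite -sumrB mulr_sumr; apply: eq_bigr => j _; rewrite !mxE /dloss; ring.
rewrite -(opprB (fsum f theta z.1)) mulrN lerBlDr => H.
by rewrite lerBlDr addrC.
Qed.

Lemma grad_emp_risk n (z : 'I_n -> XT * YT) (theta : 'rV[R]_M) j :
  grad (emp_risk gamma f z) theta 0 j =
  n%:R^-1 * \sum_i dloss theta j (z i).
Proof.
rewrite mxE derive_along_line.
have -> : (fun h => emp_risk gamma f z (h *: delta_mx 0 j + theta)) =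
    n%:R^-1 \*: (\sum_(i < n) (gamma (z i).2 \o
      (fun h => fsum f theta (z i).1 + h * f j (z i).1))).
  apply/funext => h; rewrite /emp_risk /= fct_sumE; congr (_ * _).
  by apply: eq_bigr => i _; rewrite /Qloss fsum_add_coord.
apply: derive_val; apply: is_deriveZ; apply: is_derive_sum => i.
apply: is_derive1_comp.
  rewrite mul0r addr0 derive1E; exact: derivableP.
have -> : (fun h : R => fsum f theta (z i).1 + h * f j (z i).1) =
    cst (fsum f theta (z i).1) + f j (z i).1 \*: (id : R -> R).
  by apply/funext => h /=; rewrite mulrC.
apply: is_derive_eq (is_deriveD (is_derive_cst _ _ _) (is_deriveZ _ (is_derive_id _ _))) _.
by rewrite add0r -[_ *: 1]/(_ * 1) mulr1.
Qed.

(** Convexity bounds the increment by the gradient at [theta] paired with theta - theta', and the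
    sup norm is dual to the l1-norm. *)
Lemma emp_risk_convex_le n (z : 'I_n -> XT * YT) (theta theta' : 'rV[R]_M) (r : R) :
  `|grad (emp_risk gamma f z) theta| <= r ->
  emp_risk gamma f z theta - emp_risk gamma f z theta' <= r * l1norm (theta - theta').
Proof.
move=> gr.
apply: (@le_trans _ _ (\sum_j grad (emp_risk gamma f z) theta 0 j * (theta - theta') 0 j)).
  rewrite -mulrBr -sumrB.
  under [leRHS]eq_bigr do rewrite grad_emp_risk -mulrA mulr_suml.
  rewrite -mulr_sumr exchange_big/=; apply: ler_wpM2l; first by rewrite invr_ge0.
  by apply: ler_sum => i _; exact: convex_loss_le.
rewrite mulr_sumr; apply: ler_sum => j _; apply: (le_trans (ler_norm _)).
by rewrite normrM ler_wpM2r//; apply: le_trans gr; exact: coord_le_norm.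
Qed.

End Gradient.

(** * First-order condition at a minimizer of the risk *)

Section FirstOrder.
Context {R : realType} {d dX dY : measure_display} {Om : measurableType d}
  {XT : measurableType dX} {YT : measurableType dY} {P : probability Om R}
  {M : nat} {Z : {RV P >-> (XT * YT)%type}} {f : 'I_M -> XT -> R}
  {gamma : YT -> R -> R} {L : R}.
Hypothesis hfmeas : forall j, measurable_fun [set: XT] (f j).
Hypothesis hfoo : forall j, (normoo (lawX Z) (f j) <= L%:E)%E.
Hypothesis hgmeas : measurable_fun [set: YT * R] (fun yu => gamma yu.1 yu.2).
Hypothesis hglip : forall y u u', `|gamma y u - gamma y u'| <= `|u - u'|.
Hypothesis hgdiff : forall y u, derivable (gamma y) u 1.
Hypothesis hgint : forall theta : 'rV[R]_M,
  P.-integrable [set: Om] (EFin \o (fun w => Qloss gamma f (Z w) theta)).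

Local Notation mu := (distribution P Z).
Local Notation dloss := (dloss (f := f) (gamma := gamma)).

Let quot (theta : 'rV[R]_M) (e : R) j (k : nat) z :=
  k.+1%:R * dQ (f := f) gamma theta ((k.+1%:R^-1 * e) *: delta_mx 0 j) z.

Let quot_cvg theta e j z : quot theta e j k z @[k --> \oo] --> e * dloss theta j z.
Proof.
have := @diff_quotient_cvg _ _ _ (e * f j z.1) (@hgdiff z.2 (fsum f theta z.1)).
rewrite (_ : e * f j z.1 * _ = e * dloss theta j z); last first.
  by rewrite -mulrA; congr (_ * _); exact: mulrC.
apply: cvg_trans; apply: near_eq_cvg; apply: nearW => k.
by rewrite /quot /dQ /Qloss (addrC theta) fsum_add_coord mulrA.
Qed.

Let mquot theta e j k : measurable_fun setT (quot theta e j k).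
Proof.
apply: measurable_funM => //.
by apply/measurable_EFinP; exact: (measurable_int mu (integrable_dQ hfmeas hgmeas hgint _ _)).
Qed.

Lemma measurable_dloss theta j : measurable_fun setT (dloss theta j).
Proof.
apply: (measurable_fun_cvg (h := quot theta 1 j)) => [k|z _]; first exact: mquot.
by have := @quot_cvg theta 1 j z; rewrite mul1r.
Qed.

Lemma integrable_dict j : mu.-integrable setT (fun z => (f j z.1)%:E).
Proof.
apply: (integrable_ae_bounded (phi := fun z => f j z.1) (L := L)).
  exact: (measurableT_comp (hfmeas j) measurable_fst).
exact: ae_normoo_le.
Qed.

Lemma integrable_dloss theta j : mu.-integrable setT (fun z => (dloss theta j z)%:E).
Proof.
have mdl : measurable_fun setT (fun z => (dloss theta j z)%:E).
  by apply/measurable_EFinP; exact: measurable_dloss.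
apply: (le_integrable measurableT mdl (g := fun z => ((dsup gamma)%:E * (f j z.1)%:E)%E)).
  move=> z _; rewrite -EFinM /= lee_fin !normrM.
  by rewrite ler_wpM2r// (le_trans (le_dsup hglip hgdiff _ _))// ler_norm.
by apply: integrableZl => //; exact: integrable_dict.
Qed.

(** Differentiation under the integral by dominated convergence, with dominating function D |f j|.
    By minimality all difference quotients have nonnegative integrals, in the direction e = 1 as
    well as in the direction e = -1. *)
Lemma integral_dloss_min theta j :
  (forall theta', risk gamma f P Z theta <= risk gamma f P Z theta') ->
  (\int[mu]_z (dloss theta j z)%:E = 0)%E.
Proof.
move=> hmin.
have D0 : 0 <= dsup gamma.
  exact: le_trans (normr_ge0 _) (le_dsup hglip hgdiff (@point YT) 0).
have idl := @integrable_dloss theta j.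
have key e : `|e| = 1 -> (0 <= e%:E * \int[mu]_z (dloss theta j z)%:E)%E.
  move=> e1.
  have [|||||_ _ H] := @dominated_convergence _ _ _ mu setT measurableT
    (fun k z => (quot theta e j k z)%:E) (fun z => (e * dloss theta j z)%:E)
    (fun z => ((dsup gamma)%:E * `|(f j z.1)%:E|)%E).
  - by move=> k; apply/measurable_EFinP; exact: mquot.
  - apply/measurable_EFinP; apply: measurable_funM => //; exact: measurable_dloss.
  - by apply: aeW => z _; apply: cvg_EFin; [exact: nearW|exact: quot_cvg].
  - by apply: integrableZl => //; apply: integrable_abse; exact: integrable_dict.
  - apply: aeW => z k _; rewrite /= lee_fin normrM ger0_norm//.
    rewrite -ler_pdivlMl//; apply: (le_trans (dQ_norm_le hglip hgdiff _ _ _)).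
    have := @fsum_add_coord _ _ _ _ f 0 (k.+1%:R^-1 * e) j z.1; rewrite addr0 => ->.
    rewrite /fsum big1 ?add0r; last by move=> i _; rewrite mxE mul0r.
    by rewrite !normrM e1 mulr1 ger0_norm ?invr_ge0// mulrCA.
  rewrite -integralZl//; apply: (cvge_to_ge H); apply: nearW => k /=.
  under eq_integral do rewrite EFinM.
  rewrite integralZl//; last exact: (integrable_dQ hfmeas hgmeas hgint).
  rewrite (integral_dQ hfmeas hgmeas hgint) -EFinM lee_fin mulr_ge0// subr_ge0.
  exact: hmin.
have := key 1 (normr1 _); have := key (-1) (normrN1 _).
rewrite mul1e EFinN mulN1e oppe_ge0 => H1 H2.
by apply/eqP; rewrite eq_le H1 H2.
Qed.

End FirstOrder.

(** * Rational vectors in an l1-ball and the uniform deviation bound *)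

Lemma l1norm_ge0 {R : realType} {M : nat} (theta : 'rV[R]_M) : 0 <= l1norm theta.
Proof. exact: sumr_ge0. Qed.

Section RationalBall.
Context {R : realType} {M : nat}.
Variable delta : R.
Hypothesis delta0 : 0 <= delta.

(* Codes of vectors outside the ball, and junk codes, are sent to 0. *)
Definition rat_ball (t : nat) : 'rV[R]_M :=
  if unpickle t is Some q then
    let v := map_mx ratr (q : 'rV[rat]_M) in if l1norm v <= delta then v else 0
  else 0.

Lemma l1norm_rat_ball t : l1norm (rat_ball t) <= delta.
Proof.
have l0 : l1norm (0 : 'rV[R]_M) <= delta.
  by rewrite /l1norm big1// => j _; rewrite mxE normr0.
by rewrite /rat_ball; case: (unpickle t) => [q|//] /=; case: ifPn.
Qed.

Lemma rat_ball_dense (Delta : 'rV[R]_M) (e : R) : l1norm Delta < delta -> 0 < e ->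
  exists t, forall j, `|rat_ball t 0 j - Delta 0 j| <= e.
Proof.
(* The second term keeps the approximation inside the ball: the M coordinate errors add up to at
   most delta - |Delta|_1. *)
move=> Dd e0; pose e' := Num.min e ((delta - l1norm Delta) / M.+1%:R).
have e'0 : 0 < e' by rewrite lt_min e0 divr_gt0// subr_gt0.
have /choice[q Hq] (j : 'I_M) : exists q : rat, `|ratr q - Delta 0 j| <= e'.
  have /rat_in_itvoo[q] : Delta 0 j < Delta 0 j + e' by rewrite ltrDl.
  rewrite in_itv/= => /andP[q1 q2]; exists q.
  by rewrite ger0_norm ?subr_ge0 ?(ltW q1)// lerBlDl ltW.
exists (pickle (\row_j q j)) => j; rewrite /rat_ball pickleK /=.
have -> : l1norm (map_mx ratr (\row_j q j)) <= delta.
  apply: (@le_trans _ _ (\sum_j (`|Delta 0 j| + e'))).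
    apply: ler_sum => i _; rewrite !mxE -lerBlDl.
    exact: le_trans (lerB_dist _ _) (Hq i).
  rewrite big_split/= sumr_const card_ord -mulr_natr.
  rewrite -lerBrDl; apply: (@le_trans _ _ (((delta - l1norm Delta) / M.+1%:R) * M%:R)).
    by apply: ler_wpM2r => //; rewrite ge_min lexx orbT.
  rewrite -mulrA ler_piMr ?subr_ge0 ?(ltW Dd)//.
  by rewrite ler_pdivrMl// mulr1 ler_nat.
by rewrite !mxE; apply: (le_trans (Hq j)); rewrite ge_min lexx.
Qed.

End RationalBall.

Section UniformDeviation.
Context {R : realType} {d dX dY : measure_display} {Om : measurableType d}
  {XT : measurableType dX} {YT : measurableType dY} {P : probability Om R}
  {n M : nat} {Z : {RV P >-> (XT * YT)%type}}
  {Zs : 'I_n -> {RV P >-> (XT * YT)%type}} {f : 'I_M -> XT -> R}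
  {gamma : YT -> R -> R} {L : R}.
Hypothesis hindep : mutually_independent P (fun i => Zs i : Om -> XT * YT).
Hypothesis hident : forall i, identically_distributed P (Zs i) Z.
Hypothesis hfmeas : forall j, measurable_fun [set: XT] (f j).
Hypothesis hf2 : forall j, 'N[lawX Z]_2%:E[EFin \o f j]%E = 1%E.
Hypothesis hfoo : forall j, (normoo (lawX Z) (f j) <= L%:E)%E.
Hypothesis hgmeas : measurable_fun [set: YT * R] (fun yu => gamma yu.1 yu.2).
Hypothesis hglip : forall y u u', `|gamma y u - gamma y u'| <= `|u - u'|.
Hypothesis hgdiff : forall y u, derivable (gamma y) u 1.
Hypothesis hgint : forall theta : 'rV[R]_M,
  P.-integrable [set: Om] (EFin \o (fun w => Qloss gamma f (Z w) theta)).

Local Notation mu := (distribution P Z).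
Local Notation risk := (risk gamma f P Z).
Local Notation D := (dsup gamma).

Variable theta : 'rV[R]_M.

(* [n] times the difference between the true and the empirical excess risk of
   [theta + Delta] over [theta]. *)
Definition risk_dev (Delta : 'rV[R]_M) (w : Om) : R :=
  \sum_(i < n) ((risk (theta + Delta) - risk theta) - dQ (f := f) gamma theta Delta (Zs i w)).

Lemma dsup_ge0 : 0 <= D.
Proof. exact: le_trans (normr_ge0 _) (le_dsup hglip hgdiff (@point YT) 0). Qed.

Let envelope (z : XT * YT) := D * \sum_j `|f j z.1|.

Let dQ_envelope (Delta Delta' : 'rV[R]_M) (e : R) z :
  (forall j, `|Delta 0 j - Delta' 0 j| <= e) ->
  `|dQ (f := f) gamma theta Delta z - dQ (f := f) gamma theta Delta' z| <= e * envelope z.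
Proof.
move=> De; apply: (le_trans (dQ_lipschitz hglip hgdiff _ _ _ _)).
rewrite mulrCA; apply: ler_wpM2l; first exact: dsup_ge0.
apply: (le_trans (fsum_norm_le _ _)); rewrite mulr_sumr; apply: ler_sum => j _.
by apply: ler_wpM2r => //; rewrite !mxE.
Qed.

Let ienvelope : mu.-integrable setT (EFin \o envelope).
Proof.
have -> : EFin \o envelope = (fun z => D%:E * \sum_j `|(f j z.1)%:E|)%E.
  by apply/funext => z; rewrite /envelope/= EFinM sumEFin.
apply: integrableZl => //; apply: integrable_sum => // j _.
by apply: integrable_abse; exact: (integrable_dict hfmeas hfoo).
Qed.

(** Lipschitz dependence on Delta for the sup distance, with a constant that may depend on w,
    carries a bound from the rational vectors over to the whole open ball. *)
Lemma risk_dev_continuous w : exists2 C : R, 0 <= C & forall (Delta Delta' : 'rV[R]_M) e,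
  (forall j, `|Delta 0 j - Delta' 0 j| <= e) ->
  risk_dev Delta w <= risk_dev Delta' w + e * C.
Proof.
have env0 z : 0 <= envelope z by rewrite mulr_ge0 ?dsup_ge0// sumr_ge0.
have C10 : 0 <= fine (\int[mu]_z (envelope z)%:E)%E.
  by apply: fine_ge0; apply: integral_ge0 => z _; rewrite lee_fin.
exists (\sum_(i < n) (fine (\int[mu]_z (envelope z)%:E)%E + envelope (Zs i w))).
  by apply: sumr_ge0 => i _; rewrite addr_ge0.
move=> Delta Delta' e De; rewrite mulr_sumr -big_split/=; apply: ler_sum => i _.
have H1 : risk (theta + Delta) - risk theta <= risk (theta + Delta') - risk theta +
    e * fine (\int[mu]_z (envelope z)%:E)%E.
  rewrite -lee_fin [leRHS]EFinD EFinM fineK; last exact: integrable_fin_num ienvelope.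
  rewrite -!(integral_dQ hfmeas hgmeas hgint) -integralZl//.
  rewrite -integralD//; [|exact: integrable_dQ|exact: integrableZl].
  apply: le_integral => //; first exact: integrable_dQ.
    by apply: integrableD => //; [exact: integrable_dQ|exact: integrableZl].
  move=> z _; rewrite -EFinM -EFinD lee_fin.
  have := dQ_envelope z De; rewrite ler_norml => /andP[_]; rewrite lerBlDl.
  exact.
have := dQ_envelope (Zs i w) De; rewrite ler_norml => /andP[H2 _].
rewrite mulrDr; lra.
Qed.

Lemma uniform_deviation (delta s x : R) : (0 < M)%N -> 0 < D -> 0 < delta -> 0 <= s ->
    s * L <= 1 ->
  exists A : set Om, [/\ measurable A,
    (P A <= (expR (- x) * (expR (2 * s ^+ 2) ^+ n * (2 * M%:R)))%:E)%E &
    forall w, ~ A w -> forall Delta, l1norm Delta < delta ->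
      s / (2 * D * delta) * risk_dev Delta w <= x].
Proof.
move=> M0 D0 d0 s0 sL.
(* Chosen so that 2 la times the increment of the loss, the 2 coming from symmetrization, is
   dominated by (s / delta) f_Delta, which is plus or minus s f_j at the vertices of the ball. *)
pose la := s / (2 * D * delta).
have la0 : 0 <= la by rewrite divr_ge0// !mulr_ge0// ltW.
have laE : 2 * la * D = s / delta by rewrite /la; field; rewrite !gt_eqF.
rewrite -/la; clearbody la.
pose E t := rat_ball (M := M) delta t.
have El t : \sum_j `|E t 0 j| <= delta by exact: (l1norm_rat_ball (ltW d0)).
pose g t z := la * dQ (f := f) gamma theta (E t) z.
have ig t : mu.-integrable setT (EFin \o g t).
  have -> : EFin \o g t = (fun z => la%:E * (dQ (f := f) gamma theta (E t) z)%:E)%E.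
    by apply/funext => z; rewrite /= EFinM.
  by apply: integrableZl => //; exact: integrable_dQ.
have gE t : fine (\int[mu]_z (g t z)%:E)%E = la * (risk (theta + E t) - risk theta).
  rewrite /g; under eq_integral do rewrite EFinM.
  rewrite integralZl//; last exact: integrable_dQ.
  by rewrite (integral_dQ hfmeas hgmeas hgint).
pose u j (z : XT * YT) := s / delta * f j z.1.
have mf j : measurable_fun setT (fun z : XT * YT => f j z.1).
  exact: (measurableT_comp (hfmeas j) measurable_fst).
have um j : measurable_fun setT (u j) by exact: measurable_funM.
have tauE (v : 'rV[R]_M) z : \sum_j v 0 j * u j z = s / delta * fsum f v z.1.
  by rewrite mulr_sumr; apply: eq_bigr => j _; rewrite mulrCA.
have sd0 : 0 <= s / delta by rewrite divr_ge0// ltW.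
have la2 : 0 <= 2 * la by rewrite mulr_ge0.
have gg_tau t t' z : `|2 * g t z - 2 * g t' z| <=
    `|\sum_j E t 0 j * u j z - \sum_j E t' 0 j * u j z|.
  rewrite !tauE /g !(mulrA 2) -!mulrBr fsumB normrM [leRHS]normrM (ger0_norm sd0).
  rewrite (ger0_norm la2) -laE -[leRHS]mulrA; apply: ler_wpM2l => //.
  exact: dQ_lipschitz.
have g_tau t z : `|2 * g t z| <= `|\sum_j E t 0 j * u j z|.
  rewrite tauE /g (mulrA 2) normrM [leRHS]normrM (ger0_norm sd0).
  rewrite (ger0_norm la2) -laE -[leRHS]mulrA; apply: ler_wpM2l => //.
  exact: dQ_norm_le.
have cosh_le j : (\int[mu]_z (2^-1 * (expR (delta * u j z) +
    expR (- (delta * u j z))))%:E <= (expR (2 * s ^+ 2))%:E)%E.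
  have uE z : delta * u j z = s * f j z.1 by rewrite /u; field; rewrite gt_eqF.
  under eq_integral do rewrite !uE.
  apply: (integral_cosh_le (phi := fun z => f j z.1) (L := L)) => //.
    exact: ae_normoo_le.
  by rewrite (integral_sqr_dict hfmeas (hf2 j)).
have [mA PA] := prob_exists_dev_nat_le (mu := mu) hindep hident (Ordinal M0) x El ig um
  g_tau gg_tau cosh_le.
set A := [set w | _] in mA PA; exists A; split => // w nA Delta Dd.
have [C C0 HC] := risk_dev_continuous w.
apply/ler_addgt0Pr => e e0.
(* Small enough that the Lipschitz error la C e' is at most e; the 1 keeps the denominator
   positive. *)
pose e' := e / (la * C + 1).
have laC : 0 < la * C + 1 by rewrite ltr_wpDl// mulr_ge0.
have e'0 : 0 < e' by rewrite divr_gt0.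
have [t Ht] := rat_ball_dense Dd e'0.
have dev_t : la * risk_dev (E t) w < x.
  rewrite ltNge; apply/negP => H; apply: nA; exists t; apply: (le_trans H).
  rewrite le_eqVlt; apply/orP; left; apply/eqP; rewrite mulr_sumr; apply: eq_bigr => i _.
  by rewrite gE mulrBr.
have := HC Delta (E t) e'; move=> /(_ (fun j => ltac:(rewrite distrC; exact: Ht j))) H.
apply: (@le_trans _ _ (la * risk_dev (E t) w + la * (e' * C))).
  by rewrite -mulrDr; exact: ler_wpM2l.
apply: lerD; first exact: ltW.
rewrite mulrCA /e' -mulrA ler_piMr ?(ltW e0)// ler_pdivrMl// mulr1.
by rewrite lerDl.
Qed.

End UniformDeviation.

(** * Union bound and deviation of the gradient at the target *)

Lemma prob_exists_le {R : realType} {d : measure_display} {Om : measurableType d}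
    (P : probability Om R) (I : finType) (A : I -> set Om) (p : R) :
    (forall i, measurable (A i)) -> (forall i, P (A i) <= p%:E)%E ->
  measurable [set w | exists i, A i w] /\
  (P [set w | exists i, A i w] <= (#|I|%:R * p)%:E)%E.
Proof.
move=> mA PA.
pose U (s : seq I) := [set w | exists2 i, i \in s & A i w].
have -> : [set w | exists i, A i w] = U (enum I).
  by apply/seteqP; split => [w [i Ai]|w [i _ Ai]]; exists i; rewrite ?mem_enum.
rewrite cardE; elim: (enum I) => [|i s [mU PU]].
  have -> : U [::] = set0 by apply/seteqP; split => // w [].
  by rewrite measure0 mul0r.
have -> : U (i :: s) = A i `|` U s.
  apply/seteqP; split => [w [k]|w [Ai|[k ks Ak]]].
  - by rewrite inE => /orP[/eqP ->|ks] Ak; [left|right; exists k].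
  - by exists i => //; rewrite mem_head.
  - by exists k => //; rewrite inE ks orbT.
split; first exact: measurableU.
apply: (le_trans (measureU2 _ (mA i) mU)).
by rewrite /= -add1n natrD mulrDl mul1r EFinD leeD.
Qed.

Section GradientEvent.
Context {R : realType} {d dX dY : measure_display} {Om : measurableType d}
  {XT : measurableType dX} {YT : measurableType dY} {P : probability Om R}
  {n M : nat} {Z : {RV P >-> (XT * YT)%type}}
  {Zs : 'I_n -> {RV P >-> (XT * YT)%type}} {f : 'I_M -> XT -> R}
  {gamma : YT -> R -> R} {L : R}.
Hypothesis hindep : mutually_independent P (fun i => Zs i : Om -> XT * YT).
Hypothesis hident : forall i, identically_distributed P (Zs i) Z.
Hypothesis hfmeas : forall j, measurable_fun [set: XT] (f j).
Hypothesis hf2 : forall j, 'N[lawX Z]_2%:E[EFin \o f j]%E = 1%E.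
Hypothesis hfoo : forall j, (normoo (lawX Z) (f j) <= L%:E)%E.
Hypothesis hgmeas : measurable_fun [set: YT * R] (fun yu => gamma yu.1 yu.2).
Hypothesis hglip : forall y u u', `|gamma y u - gamma y u'| <= `|u - u'|.
Hypothesis hgdiff : forall y u, derivable (gamma y) u 1.
Hypothesis hgint : forall theta : 'rV[R]_M,
  P.-integrable [set: Om] (EFin \o (fun w => Qloss gamma f (Z w) theta)).

Local Notation mu := (distribution P Z).
Local Notation D := (dsup gamma).

(** Divided by D, the partial derivatives are centred at a minimizer and dominated by |f j|, hence
    bounded by L with second moment at most 1. Chernoff's bound is applied to each coordinate and
    each sign, 2 M events in all. *)
Lemma gradient_deviation theta (s x : R) : 0 < D -> 0 <= s -> s * L <= 1 ->
    (forall theta', risk gamma f P Z theta <= risk gamma f P Z theta') ->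
  exists A : set Om, [/\ measurable A,
    (P A <= ((2 * M)%:R * (expR (- (s * x)) * expR (2 * s ^+ 2) ^+ n))%:E)%E &
    forall w, ~ A w -> forall j,
      `|\sum_(i < n) dloss (f := f) (gamma := gamma) theta j (Zs i w)| <= D * x].
Proof.
move=> D0 s0 sL hmin.
pose phi (b : bool) (j : 'I_M) z := (-1) ^+ b / D * dloss (f := f) (gamma := gamma) theta j z.
have mdl j := measurable_dloss hfmeas hgmeas hgdiff hgint theta j.
have mphi b j : measurable_fun setT (phi b j) by exact: measurable_funM.
have phi_f b j z : `|phi b j z| <= `|f j z.1|.
  rewrite /phi /dloss !normrM normrX normrN1 expr1n mul1r mulrA ler_piMl//.
  by rewrite normfV (gtr0_norm D0) ler_pdivrMl// mulr1 le_dsup.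
have mf2 j : measurable_fun setT (fun z : XT * YT => (f j z.1 ^+ 2)%:E).
  apply/measurable_EFinP; apply: measurable_funX.
  exact: (measurableT_comp (hfmeas j) measurable_fst).
have phi2 b j : (\int[mu]_z (phi b j z ^+ 2)%:E <= 1)%E.
  rewrite -(integral_sqr_dict hfmeas (hf2 j)); apply: ge0_le_integral => //.
  - by move=> z _; rewrite lee_fin sqr_ge0.
  - by apply/measurable_EFinP; exact: measurable_funX.
  - move=> z _; rewrite lee_fin -(real_normK (num_real (phi b j z))).
    by rewrite -(real_normK (num_real (f j z.1))) lerXn2r// nnegrE.
have phiL b j : {ae mu, forall z, `|phi b j z| <= L}.
  by apply: filterS (ae_normoo_le (hfoo j)) => z; apply: le_trans; exact: phi_f.
have phi0 b j : (\int[mu]_z (phi b j z)%:E = 0)%E.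
  rewrite /phi; under eq_integral do rewrite EFinM.
  have dl0 := integral_dloss_min hfmeas hfoo hgmeas hglip hgdiff hgint j hmin.
  rewrite integralZl ?dl0 ?mule0//.
  exact: integrable_dloss.
pose B (bj : bool * 'I_M) := [set w | x <= \sum_(i < n) phi bj.1 bj.2 (Zs i w)].
have [||mA PA] := @prob_exists_le _ _ _ P _ B (expR (- (s * x)) * expR (2 * s ^+ 2) ^+ n).
- by move=> bj; exact: measurable_sum_sample_ge.
- move=> bj; apply: (chernoff_sample (mu := mu) hindep hident) => //.
  exact: integral_expR_le.
eexists; split; [exact: mA|by rewrite card_prod card_bool card_ord in PA|].
move=> w nA j.
have small b : \sum_(i < n) phi b j (Zs i w) < x.
  by rewrite ltNge; apply/negP => H; apply: nA; exists (b, j).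
have [H1 H2] := (small false, small true).
move: H1 H2; rewrite -!mulr_sumr expr0 expr1 mul1r mulN1r mulNr ltrNl.
rewrite !ltr_pdivrMl// ltr_pdivlMl// mulrN => H1 H2.
by rewrite ler_norml (ltW H1) ltW.
Qed.

End GradientEvent.

(** * Cone condition and restricted eigenvalue *)

Section Cone.
Context {R : realType} {M : nat}.
Implicit Types (theta Delta : 'rV[R]_M) (J : {set 'I_M}).

Lemma l1norm_vrestr Delta J :
  l1norm Delta = l1norm (vrestr Delta J) + l1norm (vrestr Delta (~: J)).
Proof.
rewrite /l1norm -big_split; apply: eq_bigr => j _ /=; rewrite !mxE inE.
by case: ifP => _; rewrite normr0 ?addr0 ?add0r.
Qed.

(** The nonnegative difference |theta|_1 - |theta'|_1 is compared coordinate by coordinate: a term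
    is at most |theta'_j - theta_j| on the support of theta and equals -|theta'_j - theta_j| off
    it. *)
Lemma cone_of_l1norm_le theta theta' : l1norm theta' <= l1norm theta ->
  l1norm (vrestr (theta' - theta) (~: vsupp theta)) <=
  l1norm (vrestr (theta' - theta) (vsupp theta)).
Proof.
move=> H; rewrite -subr_ge0; apply: (@le_trans _ _ (l1norm theta - l1norm theta')).
  by rewrite subr_ge0.
rewrite /l1norm -!sumrB; apply: ler_sum => j _; rewrite !mxE !inE.
have [->|t0] := eqVneq (theta 0 j) 0; rewrite /= normr0; first by rewrite subr0.
by rewrite subr0 distrC lerB_dist.
Qed.

Lemma l1norm_le_l2norm Delta J s : (#|J| <= s)%N ->
  l1norm (vrestr Delta J) <= Num.sqrt s%:R * l2norm (vrestr Delta J).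
Proof.
move=> Js; set v := vrestr Delta J.
have vJ j : j \notin J -> v 0 j = 0 by rewrite mxE => /negbTE ->.
have l1E : l1norm v = \sum_(j in J) `|v 0 j|.
  rewrite /l1norm [RHS]big_mkcond; apply: eq_bigr => j _.
  by case: ifPn => // /vJ ->; rewrite normr0.
have l2E : \sum_j v 0 j ^+ 2 = \sum_(j in J) v 0 j ^+ 2.
  by rewrite [RHS]big_mkcond; apply: eq_bigr => j _; case: ifPn => // /vJ ->; rewrite expr0n.
have s2 : 0 <= \sum_j v 0 j ^+ 2 by apply: sumr_ge0 => j _; exact: sqr_ge0.
set S := l1norm v in l1E *; set Q := \sum_j v 0 j ^+ 2 in l2E s2 *.
have S0 : 0 <= S by exact: l1norm_ge0.
rewrite /l2norm -/Q -sqrtrM// -[leLHS](ger0_norm S0) -sqrtr_sqr ler_wsqrtr//.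
apply: (@le_trans _ _ (#|J|%:R * Q)); last by rewrite ler_wpM2r// ler_nat.
have [J0|J0] := eqVneq #|J| 0%N.
  move: l1E; rewrite big_pred0 => [-> |j]; first by rewrite expr0n J0 mul0r.
  by move/eqP: J0; rewrite cards_eq0 => /eqP ->; rewrite inE.
have c0 : 0 < #|J|%:R :> R by rewrite ltr0n lt0n.
(* The Cauchy-Schwarz inequality, as nonnegativity of the variance of |v j| over J. *)
have : 0 <= \sum_(j in J) (`|v 0 j| - S / #|J|%:R) ^+ 2.
  by apply: sumr_ge0 => j _; exact: sqr_ge0.
under eq_bigr do rewrite sqrrB real_normK ?num_real// -mulr_natr -mulrA.
rewrite big_split/= sumrB -l2E -mulr_suml -l1E sumr_const -[_ *+ #|J|]mulr_natr.
rewrite (_ : _ + _ = Q - S ^+ 2 / #|J|%:R); last by field; rewrite gt_eqF.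
by rewrite subr_ge0 ler_pdivrMr// mulrC mul1r.
Qed.

End Cone.

Section Compatibility.
Context {R : realType} {dX : measure_display} {XT : measurableType dX} {M : nat}
  {PX : probability XT R} {f : 'I_M -> XT -> R}.

Lemma norm2_ge0 g : 0 <= norm2 PX g.
Proof. by apply: fine_ge0; exact: Lnorm_ge0. Qed.

Lemma zeta_l2norm_le s (Delta : 'rV[R]_M) (J : {set 'I_M}) : (#|J| <= s)%N ->
  0 < zeta PX f s ->
  l1norm (vrestr Delta (~: J)) <= l1norm (vrestr Delta J) ->
  zeta PX f s * l2norm (vrestr Delta J) <= norm2 PX (fsum f Delta).
Proof.
move=> Js z0 cone.
have [D0|D0] := eqVneq Delta 0.
  rewrite D0 (_ : l2norm _ = 0) ?mulr0 ?norm2_ge0//.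
  by rewrite /l2norm big1 ?sqrtr0// => j _; rewrite !mxE if_same expr0n.
have zle : zeta PX f s <= norm2 PX (fsum f Delta) / l2norm (vrestr Delta J).
  apply: ge_inf; last by exists J, Delta.
  by exists 0 => _ [J' [Delta' [_ _ _ ->]]]; rewrite divr_ge0 ?norm2_ge0 ?sqrtr_ge0.
have [l0|l0] := eqVneq (l2norm (vrestr Delta J)) 0; first by rewrite l0 mulr0 norm2_ge0.
by rewrite -ler_pdivlMr// lt_neqAle eq_sym l0 sqrtr_ge0.
Qed.

(** The cone condition gives the factor 2, the Cauchy-Schwarz inequality on the support gives sqrt
    s, and the restricted eigenvalue leads to the norm of f_Delta. *)
Lemma l1norm_le_norm2 s (theta theta' : 'rV[R]_M) : (#|vsupp theta| <= s)%N ->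
  0 < zeta PX f s -> l1norm theta' <= l1norm theta ->
  l1norm (theta' - theta) <=
    2 * Num.sqrt s%:R / zeta PX f s * norm2 PX (fsum f (theta' - theta)).
Proof.
move=> Js z0 /cone_of_l1norm_le cone.
have H1 := l1norm_le_l2norm (theta' - theta) Js.
have H2 := zeta_l2norm_le Js z0 cone.
rewrite (l1norm_vrestr _ (vsupp theta)).
apply: (@le_trans _ _ (2 * (Num.sqrt s%:R * l2norm (vrestr (theta' - theta) (vsupp theta))))).
  by move: H1 cone; lra.
rewrite -!mulrA ler_pM2l// ler_wpM2l ?sqrtr_ge0//.
by rewrite mulrC ler_pdivlMr// mulrC.
Qed.

End Compatibility.

(** * The trivial bound on the excess risk *)

Section ExcessRisk.
Context {R : realType} {d dX dY : measure_display} {Om : measurableType d}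
  {XT : measurableType dX} {YT : measurableType dY} {P : probability Om R}
  {M : nat} {Z : {RV P >-> (XT * YT)%type}} {f : 'I_M -> XT -> R}
  {gamma : YT -> R -> R}.
Hypothesis hfmeas : forall j, measurable_fun [set: XT] (f j).
Hypothesis hgmeas : measurable_fun [set: YT * R] (fun yu => gamma yu.1 yu.2).
Hypothesis hglip : forall y u u', `|gamma y u - gamma y u'| <= `|u - u'|.
Hypothesis hgdiff : forall y u, derivable (gamma y) u 1.
Hypothesis hgint : forall theta : 'rV[R]_M,
  P.-integrable [set: Om] (EFin \o (fun w => Qloss gamma f (Z w) theta)).

Local Notation mu := (distribution P Z).

Lemma excess_risk_le theta theta' (K : R) : 0 <= K -> Theta (lawX Z) f K theta ->
  Theta (lawX Z) f K theta' ->
  risk gamma f P Z theta' - risk gamma f P Z theta <= 2 * K * dsup gamma.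
Proof.
move=> K0 T1 T2.
have D0 := dsup_ge0 hglip hgdiff.
have idQ := integrable_dQ hfmeas hgmeas hgint theta (theta' - theta).
rewrite -lee_fin -[theta' in X in (X%:E <= _)%E](subrKC theta).
rewrite -(integral_dQ hfmeas hgmeas hgint).
have mdQ := measurable_int _ idQ.
apply: (le_trans (lee_abs _)); apply: (le_trans (le_abse_integral _ measurableT mdQ)).
rewrite -[leRHS](integral_probability_cst mu).
apply: (@ae_ge0_le_integral _ _ _ mu) => //.
- exact: measurableT_comp.
- by move=> z _; rewrite lee_fin !mulr_ge0.
apply: filterS2 (ae_normoo_le T1) (ae_normoo_le T2) => z H1 H2 _ /=.
rewrite lee_fin mulrC; apply: (le_trans (dQ_norm_le hglip hgdiff _ _ _)).
rewrite ler_wpM2l// -fsumB; apply: (le_trans (ler_normB _ _)); lra.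
Qed.

End ExcessRisk.

(** * Numerical rates *)

Section Rates.
Context {R : realType}.
Variables (n M : nat) (L K rt : R).
Hypotheses (hn : (1 <= n)%N) (hM : (2 <= M)%N).
Hypothesis hK4 : 1 <= K <= Num.sqrt (n%:R / ln M%:R).
Hypothesis hL4 : 1 <= L <= Num.sqrt (n%:R / ln M%:R).
Hypothesis hrt : rt = 4 * Num.sqrt 2 * L * (ln M%:R / n%:R)
  + 2 * Num.sqrt 6 * Num.sqrt (ln M%:R / n%:R).
Hypothesis hrt1 : rt <= 1.

Let a : R := ln M%:R.
Let N : R := n%:R / a.
(** The parameter s of the exponential moments: sg L <= 1 by the assumption on L, and n sg^2 = ln M
    makes the n-th power of the moment bound equal to M^2. *)
Let sg : R := Num.sqrt (a / n%:R).

Lemma lnM_gt0 : 0 < a.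
Proof. by rewrite ln_gt0// ltr1n. Qed.

Let n0 : 0 < n%:R :> R. Proof. by rewrite ltr0n. Qed.

Let an0 : 0 < a / n%:R. Proof. by rewrite divr_gt0// lnM_gt0. Qed.

Lemma sg_gt0 : 0 < sg. Proof. by rewrite sqrtr_gt0. Qed.

Lemma sg_sqr : n%:R * sg ^+ 2 = a.
Proof. by rewrite sqr_sqrtr ?(ltW an0)// mulrCA mulfV ?mulr1// gt_eqF. Qed.

Lemma sg_sqrtN : sg * Num.sqrt N = 1.
Proof.
rewrite -sqrtrM ?(ltW an0)// /N -[n%:R / a]invf_div mulfV ?sqrtr1//.
by rewrite gt_eqF.
Qed.

Lemma sg_L : sg * L <= 1.
Proof.
case/andP: hL4 => _ LN; rewrite -sg_sqrtN.
by rewrite ler_wpM2l// ltW// sg_gt0.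
Qed.

Lemma rt_ge_sg : 4 * sg <= rt.
Proof.
have h6 : 2 <= Num.sqrt 6 :> R.
  rewrite -(@ger0_norm _ (2 : R))// -sqrtr_sqr ler_wsqrtr// expr2; lra.
have h1 : 0 <= 4 * Num.sqrt 2 * L * (a / n%:R).
  have L0 : 0 <= L by case/andP: hL4 => /(le_trans ler01).
  by apply: mulr_ge0 (ltW an0); rewrite !mulr_ge0 ?sqrtr_ge0.
rewrite hrt -/a -/sg; have := sg_gt0; nra.
Qed.

Lemma rt_gt0 : 0 < rt.
Proof. by apply: lt_le_trans rt_ge_sg; rewrite mulr_gt0// sg_gt0. Qed.

Lemma sg_n_rt : 4 * a <= sg * (n%:R * rt).
Proof.
rewrite -{1}sg_sqr mulrCA [leRHS]mulrCA ler_pM2l//.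
rewrite (_ : 4 * sg ^+ 2 = sg * (4 * sg)); last by ring.
by rewrite ler_pM2l ?sg_gt0// rt_ge_sg.
Qed.

(** From 4 sg <= rt <= 1 and N sg^2 = 1. *)
Lemma N_ge16 : 16 <= N.
Proof.
have s4 : sg <= 4^-1 by have := le_trans rt_ge_sg hrt1; lra.
rewrite /N ler_pdivlMr ?lnM_gt0// -sg_sqr mulrCA -[leRHS]mulr1 ler_pM2l//.
have := sg_gt0; nra.
Qed.

Lemma lnN_ge1 : 1 <= ln N.
Proof.
have N16 := N_ge16.
rewrite -[leLHS]expRK ler_ln ?posrE ?expR_gt0//; last by lra.
have := @expR_le_quad R 1; rewrite normr1 => /(_ (lexx _)); lra.
Qed.

Lemma expR_2lnN_le (m : nat) : ln N * 2 <= m%:R -> N ^+ 2 <= 4 ^+ m.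
Proof.
move=> lm; have N16 := N_ge16.
apply: (@le_trans _ _ (expR m%:R)).
  apply: (@le_trans _ _ (expR (ln N * 2))); last by rewrite ler_expR.
  by rewrite expRM_natr lnK// posrE; lra.
rewrite -[m%:R]mul1r expRM_natr lerXn2r// ?nnegrE ?expR_ge0//.
have := @expR_le_quad R 1; rewrite normr1 => /(_ (lexx _)); lra.
Qed.

(** As 4 >= exp 1, at least 2 ln N shells of ratio 4 gain a factor N^2, while K <= N and N rt^2 >=
    1. *)
Lemma shells_cover (m : nat) : ln N * 2 <= m%:R -> 1 <= 6 * rt * (4 ^+ m * rt / K).
Proof.
move=> /expR_2lnN_le N4; have N16 := N_ge16.
case/andP: hK4 => K1; rewrite -/a -/N => KN.
have KN' : K <= N.
  apply: (le_trans KN); rewrite -[leRHS]ger0_norm; last by lra.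
  by rewrite -sqrtr_sqr ler_wsqrtr// expr2 ler_peMr//; lra.
rewrite -(@ler_pM2l _ (K * N)); last by rewrite mulr_gt0//; lra.
rewrite mulr1 [leRHS](_ : _ = 4 ^+ m * (6 * (N * rt ^+ 2))); last first.
  by move: (4 ^+ m) => q; field; rewrite gt_eqF//; lra.
have Nrt : 1 <= N * rt ^+ 2.
  rewrite -[leLHS](expr1n _ 2) -sg_sqrtN mulrC exprMn sqr_sqrtr; last by lra.
  rewrite ler_pM2l; last by lra.
  rewrite lerXn2r// ?nnegrE ?(ltW sg_gt0) ?(ltW rt_gt0)//.
  by have := rt_ge_sg; have := sg_gt0; lra.
apply: (@le_trans _ _ (4 ^+ m * 1)); last by rewrite ler_pM2l ?exprn_gt0//; lra.
rewrite mulr1; apply: le_trans N4; rewrite expr2 ler_wpM2r//; lra.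
Qed.

Lemma M_expR : M%:R = expR a.
Proof. by rewrite lnK// posrE ltr0n (leq_trans _ hM). Qed.

Lemma twoM_le : 2 * M%:R <= expR (2 * a).
Proof.
rewrite (_ : 2 * a = a + a) ?expRD -?M_expR; last by ring.
by rewrite ler_pM2r ?ler_nat// ltr0n (leq_trans _ hM).
Qed.

Lemma expR_sg_pow : expR (2 * sg ^+ 2) ^+ n = expR (2 * a).
Proof. by rewrite -expRM_natr -mulrA [_ * n%:R]mulrC sg_sqr. Qed.

(** The factors 2 M <= M^2 and M^2 cost 4 ln M in the exponent, against a gain of at least 24 ln M
    by [sg_n_rt]. *)
Lemma gradient_rate :
  (2 * M)%:R * (expR (- (sg * (6 * n%:R * rt))) * expR (2 * sg ^+ 2) ^+ n) <= M%:R^-1.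
Proof.
rewrite expR_sg_pow natrM M_expR -expRN.
apply: (@le_trans _ _ (expR (2 * a) * (expR (- (sg * (6 * n%:R * rt))) * expR (2 * a)))).
  by rewrite ler_wpM2r ?mulr_ge0 ?expR_ge0// -M_expR twoM_le.
rewrite -!expRD ler_expR; have := sg_n_rt; have := lnM_gt0.
rewrite (_ : sg * (6 * n%:R * rt) = 6 * (sg * (n%:R * rt))); last by ring.
lra.
Qed.

(** The gain in the exponent is at least 6 K ln M by [sg_n_rt], and the cost 4 ln M is at most 4 K
    ln M. *)
Lemma deviation_rate :
  expR (- (3 / 2 * K * (sg * (n%:R * rt)))) * (expR (2 * sg ^+ 2) ^+ n * (2 * M%:R)) <=
  M%:R `^ (- (2 * K)).
Proof.
rewrite expR_sg_pow /powR gt_eqF; last by rewrite ltr0n (leq_trans _ hM).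
rewrite -/a.
apply: (@le_trans _ _ (expR (- (3 / 2 * K * (sg * (n%:R * rt)))) *
   (expR (2 * a) * expR (2 * a)))).
  by rewrite !ler_pM2l ?expR_gt0// twoM_le.
rewrite -!expRD ler_expR; have := sg_n_rt; have := lnM_gt0.
case/andP: hK4 => K1 _; set y := sg * _ => a0 ay.
have : K * (4 * a) <= K * y by rewrite ler_pM2l//; lra.
have : a <= K * a by rewrite ler_peMl// ltW.
lra.
Qed.

End Rates.

(** * The good event, by peeling *)

Section GoodEvent.
Context {R : realType} {d dX dY : measure_display} {Om : measurableType d}
  {XT : measurableType dX} {YT : measurableType dY} {P : probability Om R}
  {n M : nat} {Z : {RV P >-> (XT * YT)%type}}
  {Zs : 'I_n -> {RV P >-> (XT * YT)%type}} {f : 'I_M -> XT -> R}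
  {gamma : YT -> R -> R} {L K rt : R}.
Hypotheses (hn : (1 <= n)%N) (hM : (2 <= M)%N).
Hypothesis hindep : mutually_independent P (fun i => Zs i : Om -> XT * YT).
Hypothesis hident : forall i, identically_distributed P (Zs i) Z.
Hypothesis hfmeas : forall j, measurable_fun [set: XT] (f j).
Hypothesis hf2 : forall j, 'N[lawX Z]_2%:E[EFin \o f j]%E = 1%E.
Hypothesis hfoo : forall j, (normoo (lawX Z) (f j) <= L%:E)%E.
Hypothesis hgmeas : measurable_fun [set: YT * R] (fun yu => gamma yu.1 yu.2).
Hypothesis hglip : forall y u u', `|gamma y u - gamma y u'| <= `|u - u'|.
Hypothesis hgdiff : forall y u, derivable (gamma y) u 1.
Hypothesis hgint : forall theta : 'rV[R]_M,
  P.-integrable [set: Om] (EFin \o (fun w => Qloss gamma f (Z w) theta)).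
Hypothesis hK4 : 1 <= K <= Num.sqrt (n%:R / ln M%:R).
Hypothesis hL4 : 1 <= L <= Num.sqrt (n%:R / ln M%:R).
Hypothesis hrt : rt = 4 * Num.sqrt 2 * L * (ln M%:R / n%:R)
  + 2 * Num.sqrt 6 * Num.sqrt (ln M%:R / n%:R).
Hypothesis hrt1 : rt <= 1.

Local Notation D := (dsup gamma).
Local Notation r := (6 * D * rt).
Local Notation N := (n%:R / @ln R M%:R).
Local Notation sg := (Num.sqrt (@ln R M%:R / n%:R)).

Lemma good_event theta : 0 < D ->
    (forall theta', risk gamma f P Z theta <= risk gamma f P Z theta') ->
  exists A : set Om, [/\ measurable A,
    ((1 - M%:R^-1 - M%:R `^ (- K) - 3 * M%:R `^ (- (2 * K)) * ln N)%:E <= P A)%E &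
    forall w, A w ->
      (forall j, `|\sum_(i < n) dloss (f := f) (gamma := gamma) theta j (Zs i w)| <=
         n%:R * r) /\
      (forall Delta : 'rV[R]_M, 6 * rt * l1norm Delta < 1 ->
         risk_dev (Z := Z) (Zs := Zs) (f := f) (gamma := gamma) theta Delta w <=
         n%:R * (2 * K * r * l1norm Delta + 2 * r * rt))].
Proof.
move=> D0 hmin.
have rt0 := rt_gt0 hn hM hL4 hrt.
have sg0 : 0 < sg := sg_gt0 hn hM.
have sL : sg * L <= 1 := sg_L hn hM hL4.
have lnN1 := lnN_ge1 hn hM hL4 hrt hrt1.
have n0 : 0 < n%:R :> R by rewrite ltr0n.
have K1 : 1 <= K by case/andP: hK4.
have K0 : 0 < K by lra.
have M0 : (0 < M)%N by exact: leq_trans hM.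
have [G [mG PG nG]] := gradient_deviation hindep hident hfmeas hf2 hfoo hgmeas hglip
  hgdiff hgint (6 * n%:R * rt) D0 (ltW sg0) sL hmin.
have {}PG : (P G <= (M%:R^-1)%:E)%E.
  by apply: (le_trans PG); rewrite lee_fin (gradient_rate hn hM hL4 hrt).
(* Outer radius of the shell k; the innermost one, 4 rt / K, is where the level K r dl / 2 equals
   the additive term 2 r rt. *)
pose dl (k : nat) := 4 ^+ k.+1 * rt / K.
have dl0 k : 0 < dl k by rewrite !mulr_gt0 ?invr_gt0 ?exprn_gt0.
pose m := Num.truncn (2 * ln N).
have /choice[B HB] (k : 'I_m.+1) : exists B : set Om, [/\ measurable B,
    (P B <= (M%:R `^ (- (2 * K)))%:E)%E &
    forall w, ~ B w -> forall Delta, l1norm Delta < dl k ->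
      risk_dev (Z := Z) (Zs := Zs) (f := f) (gamma := gamma) theta Delta w <=
      n%:R * (K * r * dl k / 2)].
  pose la := sg / (2 * D * dl k).
  have la0 : 0 < la by rewrite divr_gt0// mulr_gt0// mulr_gt0.
  have [B [mB PB nB]] := uniform_deviation hindep hident hfmeas hf2 hfoo hgmeas hglip
    hgdiff hgint theta (la * (n%:R * (K * r * dl k / 2))) M0 D0 (dl0 k) (ltW sg0) sL.
  exists B; split => //; last first.
    by move=> w /nB H Delta /H; rewrite ler_pM2l.
  apply: (le_trans PB); rewrite lee_fin.
  (* The radius cancels, so all shells have the same exponent; 3 / 2 is the 6 of r divided by the
     two factors 2. *)
  rewrite (_ : la * _ = 3 / 2 * K * (sg * (n%:R * rt))).
    exact: (deviation_rate hn hM hK4 hL4 hrt).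
  by rewrite /la; move: (dl k) (dl0 k) => q q0; field; rewrite !gt_eqF.
have mB k : measurable (B k) by case: (HB k).
have PB k : (P (B k) <= (M%:R `^ (- (2 * K)))%:E)%E by case: (HB k).
have [mU PU] := prob_exists_le mB PB.
set U := [set w | _] in mU PU; rewrite card_ord in PU.
exists (~` (G `|` U)); split; first by apply: measurableC; exact: measurableU.
  rewrite probability_setC; last exact: measurableU.
  have H : (P (G `|` U) <= (M%:R^-1 + m.+1%:R * M%:R `^ (- (2 * K)))%:E)%E.
    by rewrite EFinD; apply: (le_trans (measureU2 _ mG mU)); exact: leeD.
  apply: (@le_trans _ _ (1 - (M%:R^-1 + m.+1%:R * M%:R `^ (- (2 * K)))%:E)%E).
    rewrite -EFinB lee_fin.
    have Mp0 := powR_ge0 M%:R (- (2 * K)) : 0 <= _ :> R.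
    have MK0 := powR_ge0 M%:R (- K) : 0 <= _ :> R.
    (* There are m + 1 <= 2 ln N + 1 shells, and ln N >= 1; hence the factor 3 in the
       probability. *)
    have m3 : m.+1%:R <= 3 * ln N.
      have := truncn_le (2 * ln N); rewrite mulr_ge0 ?(le_trans ler01 lnN1)// -/m => mle.
      by rewrite -natr1; lra.
    have := ler_wpM2r Mp0 m3.
    rewrite (_ : 3 * ln N * _ = 3 * M%:R `^ (- (2 * K)) * ln N); last by ring.
    lra.
  by apply: leeB.
move=> w nGU; have nGw : ~ G w by move=> Gw; apply: nGU; left.
have nUw k : ~ B k w by move=> Bw; apply: nGU; right; exists k.
split=> [j|Delta].
  apply: (le_trans (nG w nGw j)).
  by rewrite le_eqVlt; apply/orP; left; apply/eqP; ring.
set l := l1norm Delta => lrt.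
(* The last shell has exponent m + 1 > 2 ln N, so its radius is at least 1 / (6 rt). *)
have cover : l < dl m.
  have H := shells_cover hn hM hK4 hL4 hrt hrt1 (m := m.+1).
  have {}H : 1 <= 6 * rt * dl m.
    by apply: H; rewrite mulrC ltW// truncnS_gt.
  by have := lt_le_trans lrt H; rewrite ltr_pM2l// mulr_gt0.
have ex : exists k, l < dl k by exists m.
(* The least shell containing Delta: unless it is the innermost, the preceding radius, a quarter of
   its own, is at most l, and the level becomes 2 K r times that radius. *)
case: (ex_minnP ex) => k lk kmin.
have km : (k < m.+1)%N by rewrite ltnS; exact: kmin.
have [_ _ /(_ w (nUw (Ordinal km)) Delta lk)] := HB (Ordinal km).
move=> /le_trans; apply; rewrite ler_pM2l//= -/l.
have r0 : 0 < r by rewrite !mulr_gt0.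
have l0 : 0 <= l := l1norm_ge0 Delta.
case: k lk kmin km => [|k] lk kmin km.
  rewrite /dl expr1 (_ : _ / 2 = 2 * r * rt); last by field; rewrite gt_eqF.
  by rewrite lerDr !mulr_ge0// ltW.
have lk' : dl k <= l by rewrite leNgt; apply/negP => /kmin; rewrite ltnn.
apply: (@le_trans _ _ (2 * K * r * l)); last by rewrite lerDl !mulr_ge0// ltW.
apply: (@le_trans _ _ (2 * K * r * dl k)); last by rewrite ler_pM2l// !mulr_gt0.
rewrite le_eqVlt; apply/orP; left; apply/eqP; rewrite /dl [4 ^+ k.+2]exprS.
by move: (4 ^+ k.+1) => q; field; rewrite gt_eqF.
Qed.

End GoodEvent.

(** * The oracle inequalities on the good event *)

Theorem theorem1 (R : realType)
  (d dX dY : measure_display) (Omega : measurableType d)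
  (XT : measurableType dX) (YT : measurableType dY)
  (P : probability Omega R)
  (n M s : nat) (L K c kappa rt r : R)
  (Z : {RV P >-> (XT * YT)%type})
  (Zs : 'I_n -> {RV P >-> (XT * YT)%type})
  (f : 'I_M -> XT -> R) (gamma : YT -> R -> R)
  (thetastar : 'rV[R]_M)
  (hn : (1 <= n)%N) (hM : (2 <= M)%N) (hs : (1 <= s)%N)
  (* the sample *)
  (hindep : mutually_independent P (fun i => Zs i : Omega -> XT * YT))
  (hident : forall i, identically_distributed P (Zs i) Z)
  (* the dictionary *)
  (hL : 0 < L)
  (hfmeas : forall j, measurable_fun [set: XT] (f j))
  (hf2 : forall j, 'N[lawX Z]_2%:E[EFin \o f j]%E = 1%E)
  (hfoo : forall j, (normoo (lawX Z) (f j) <= L%:E)%E)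
  (* the loss *)
  (hgmeas : measurable_fun [set: YT * R] (fun yu => gamma yu.1 yu.2))
  (hgpos : forall y u, 0 <= gamma y u)
  (hglip : forall y u u', `|gamma y u - gamma y u'| <= `|u - u'|)
  (hgconv : forall y, convex_function [set: R^o] (gamma y))
  (hgdiff : forall y u, derivable (gamma y) u 1)
  (hgac : forall y, absolutely_continuous (derive1 (gamma y)))
  (hgint : forall theta : 'rV[R]_M,
     P.-integrable [set: Omega] (EFin \o (fun w => Qloss gamma f (Z w) theta)))
  (* the target *)
  (hmin : forall theta, risk gamma f P Z thetastar <= risk gamma f P Z theta)
  (hsparse : (#|vsupp thetastar| <= s)%N)
  (huniq : forall theta' : 'rV[R]_M,
     (forall theta, risk gamma f P Z theta' <= risk gamma f P Z theta) ->
     (#|vsupp theta'| <= s)%N -> theta' = thetastar)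
  (* (1) restricted eigenvalue *)
  (hRE : 0 < zeta (lawX Z) f s)
  (* (2) *)
  (hK : 0 < K) (hstarK : (normoo (lawX Z) (fsum f thetastar) <= K%:E)%E)
  (* (3) margin *)
  (hc : 0 < c) (hkappa : 1 < kappa <= 2)
  (hmargin : forall theta, Theta (lawX Z) f K theta ->
     norm2 (lawX Z) (fun x => fsum f theta x - fsum f thetastar x) <=
     c * (risk gamma f P Z theta - risk gamma f P Z thetastar)
           `^ (kappa^-1))
  (* (4) *)
  (hK4 : 1 <= K <= Num.sqrt (n%:R / ln M%:R))
  (hL4 : 1 <= L <= Num.sqrt (n%:R / ln M%:R))
  (hrt : rt = 4 * Num.sqrt 2 * L * (ln M%:R / n%:R)
              + 2 * Num.sqrt 6 * Num.sqrt (ln M%:R / n%:R))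
  (hrt1 : rt <= 1)
  (hr : r = 6 * dsup gamma * rt) :
  exists A : set Omega,
    [/\ measurable A,
        ((1 - M%:R^-1 - M%:R `^ (- K)
           - 3 * M%:R `^ (- (2 * K)) * ln (n%:R / ln M%:R))%:E <= P A)%E &
        forall w, A w ->
        forall thetahat,
          Thetahat gamma f (fun i => Zs i w) (lawX Z) K r thetahat ->
          risk gamma f P Z thetahat - risk gamma f P Z thetastar <=
            (2 * (1 + 2 * K) * c * r * Num.sqrt s%:R / zeta (lawX Z) f s)
              `^ (kappa / (kappa - 1))
            + 12 * dsup gamma * (kappa / (kappa - 1)) * rt ^+ 2
          /\
          l1norm (thetahat - thetastar) <=
            (2 * c * Num.sqrt s%:R / zeta (lawX Z) f s)
              `^ (kappa / (kappa - 1))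
            * ((1 + 2 * K) * r) `^ ((kappa - 1)^-1)
            + 2 * K / ((kappa - 1) * (1 + 2 * K)) * rt].
Proof.
have K1 : 1 <= K by case/andP: hK4.
have D0 : 0 < dsup gamma.
  (* Otherwise the loss is constant and every vector minimizes the risk, which
     contradicts the uniqueness of the sparse minimizer. *)
  rewrite lt_neqAle (dsup_ge0 hglip hgdiff) andbT eq_sym; apply/negP => /eqP D0.
  have gcst y u u' : gamma y u = gamma y u'.
    apply/eqP; rewrite -subr_eq0 -normr_le0.
    by apply: (le_trans (dsup_lipschitz hglip hgdiff _ _ _)); rewrite D0 mul0r.
  have rcst theta theta' : risk gamma f P Z theta = risk gamma f P Z theta'.
    rewrite /risk (_ : (fun w => _) = (fun w => Qloss gamma f (Z w) theta'))//.
    by apply/funext => w; exact: gcst.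
  pose j0 : 'I_M := Ordinal (ltnW hM).
  have e1 : 0 = thetastar.
    apply: huniq => [theta|]; first by rewrite (rcst 0 theta).
    by rewrite (_ : vsupp 0 = finset.set0) ?cards0//; apply/setP => j; rewrite !inE mxE eqxx.
  have e2 : delta_mx 0 j0 = thetastar.
    apply: huniq => [theta|]; first by rewrite (rcst (delta_mx 0 j0) theta).
    rewrite (leq_trans _ hs)// (_ : vsupp _ = [set j0]%SET) ?cards1//.
    apply/setP => j; rewrite !inE mxE eqxx/=.
    by case: (j == j0); rewrite ?oner_eq0 ?eqxx.
  have := congr1 (fun v : 'rV[R]_M => v 0 j0) (etrans e1 (esym e2)).
  by rewrite !mxE !eqxx => /esym/eqP; rewrite oner_eq0.
have [A [mA PA HA]] := good_event hn hM hindep hident hfmeas hf2 hfoo hgmeas hglip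
  hgdiff hgint hK4 hL4 hrt hrt1 D0 hmin.
exists A; split => // w Aw thetahat [[hTheta hgrad] hl1min].
have [gradw devw] := HA w Aw.
have rt0 : 0 < rt := rt_gt0 hn hM hL4 hrt.
have r0 : 0 < r by rewrite hr !mulr_gt0.
have n0 : 0 < n%:R :> R by rewrite ltr0n.
(* On the good event the target satisfies the gradient constraint, so it competes in the
   minimization of the l1-norm. *)
have hl1 : l1norm thetahat <= l1norm thetastar.
  apply: hl1min; split; first exact: hstarK.
  apply: norm_le_coord => [|j]; first exact: ltW.
  rewrite (grad_emp_risk hgdiff) normrM ger0_norm ?invr_ge0//.
  by rewrite ler_pdivrMl// hr.
set l := l1norm (thetahat - thetastar).
set E := risk gamma f P Z thetahat - risk gamma f P Z thetastar.
have E0 : 0 <= E by rewrite subr_ge0.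
set z := zeta _ _ _ in hRE *.
have lE : l <= 2 * c * Num.sqrt s%:R / z * E `^ kappa^-1.
  apply: (le_trans (l1norm_le_norm2 hsparse hRE hl1)).
  have -> : fsum f (thetahat - thetastar) = (fun x => fsum f thetahat x - fsum f thetastar x).
    by apply/funext => x; rewrite fsumB.
  have s0 : 0 <= 2 * Num.sqrt s%:R / z by rewrite divr_ge0 ?mulr_ge0 ?sqrtr_ge0// ltW.
  apply: (le_trans (ler_wpM2l s0 (hmargin _ hTheta))).
  by rewrite le_eqVlt; apply/orP; left; apply/eqP; rewrite -/E; ring.
have EB : E <= (1 + 2 * K) * r * l + 2 * r * rt.
  have rl0 : 0 <= r * l by rewrite mulr_ge0 ?l1norm_ge0// ltW.
  have rrt0 : 0 <= r * rt by rewrite mulr_ge0// ltW.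
  (* In the range covered by peeling, the empirical excess risk is at most r l by convexity, and the
     deviation adds 2 K r l + 2 r rt. *)
  have [lrt|lrt] := ltP (6 * rt * l) 1.
    have := devw _ lrt; rewrite /risk_dev subrKC sumrB sumr_const card_ord.
    have -> : \sum_(i < n) dQ (f := f) gamma thetastar (thetahat - thetastar) (Zs i w) =
        n%:R * (emp_risk gamma f (fun i => Zs i w) thetahat -
                emp_risk gamma f (fun i => Zs i w) thetastar).
      rewrite -mulrBr mulrA mulfV ?gt_eqF// mul1r -sumrB.
      by apply: eq_bigr => i _; rewrite /dQ subrKC.
    rewrite -[_ *+ n]mulr_natl -mulrBr ler_pM2l// -hr -/l -/E.
    have := emp_risk_convex_le hgconv hgdiff thetastar hgrad; rewrite -/l.
    by move: (emp_risk _ _ _ _) => e1; move: (emp_risk _ _ _ _) => e2; lra.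
  (* Beyond that range 6 rt l >= 1, so the trivial bound 2 K D is at most 2 K D (6 rt l) = 2 K r
     l. *)
  have := excess_risk_le hfmeas hgmeas hglip hgdiff hgint (ltW hK) hstarK hTheta.
  rewrite -/E => EK.
  have KD0 : 0 <= 2 * K * dsup gamma by rewrite !mulr_ge0 ?ltW.
  have := ler_wpM2l KD0 lrt; rewrite mulr1 => H.
  have -> : (1 + 2 * K) * r * l = r * l + 2 * K * dsup gamma * (6 * rt * l).
    by rewrite hr; ring.
  lra.
have A0 : 0 <= 2 * c * Num.sqrt s%:R / z.
  by rewrite divr_ge0 ?mulr_ge0 ?sqrtr_ge0// ltW.
have kappa1 : 1 < kappa by case/andP: hkappa.
have [H1 H2] := oracle_algebra E0 A0 r0 (ltW rt0) K1 kappa1 lE EB.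
split=> //; apply: (le_trans H1); apply: lerD.
  rewrite le_eqVlt; apply/orP; left; apply/eqP; congr (_ `^ _).
  by ring.
by rewrite le_eqVlt; apply/orP; left; apply/eqP; rewrite hr; ring.
Qed.
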